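(* Let $n\geq 3$ be an integer, $G=SL(n,\mathbf{Z})$, and let $S=S^{-1}\subset G$ be a finite symmetric generating set. For $w=(s_1,\ldots,s_N)\in S^N$ put $g_w=s_1\cdots s_N\in G$. Then there exists $\beta>0$ such that for all $N\geq 1$, $$|\{w\in S^N \mid \text{some entry of the matrix } g_w \text{ is the square of an integer}\}|\ll |S|^{N(1-\beta)},$$ where $\beta$ and the implied constant depend only on $n$ and $S$. Equivalently, if $(X_k)$ is the simple left-invariant random walk on $G$ ($X_0=1$, $X_{k+1}=X_k\xi_{k+1}$ with $(\xi_k)$ independent and uniformly distributed on $S$), then $\mathbf{P}(\text{some entry of } X_k \text{ is a square})\ll \exp(-\delta k)$ for $k\geq 1$, for some $\delta>0$, where $\delta$ and the implied constant depend only on $n$ and $S$. *)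

(* Defs.v *)
From mathcomp Require Import all_boot all_order all_algebra.
From mathcomp Require Import boolp.
From Stdlib Require Import Reals.
Set Implicit Arguments. Unset Strict Implicit. Unset Printing Implicit Defensive.
Import GRing.Theory Num.Theory.
Local Open Scope ring_scope.

Definition inSL (n : nat) (g : 'M[int]_n) : Prop := \det g = 1.

Definition mxprod (n : nat) (l : seq 'M[int]_n) : 'M[int]_n :=
  foldr (fun s M => s *m M) 1%:M l.

Definition sym_gen_set_SL (n : nat) (S : seq 'M[int]_n) : Prop :=
  [/\ uniq S,
      (forall s, s \in S -> inSL s),
      (forall s, s \in S -> invmx s \in S) &
      (forall g, inSL g -> exists2 l : seq 'M[int]_n, all (mem S) l & g = mxprod l)].

(* g_w for a word w in S^N, words encoded as maps 'I_N -> indices in S *)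
Definition word_elt (n : nat) (S : seq 'M[int]_n) (N : nat)
  (w : {ffun 'I_N -> 'I_(size S)}) : 'M[int]_n :=
  mxprod [seq nth 1%:M S (w i) | i <- enum 'I_N].

Definition has_square_entry (n : nat) (g : 'M[int]_n) : Prop :=
  exists i j, exists m : int, g i j = m * m.

Definition count_square_words (n : nat) (S : seq 'M[int]_n) (N : nat) : nat :=
  #|[set w : {ffun 'I_N -> 'I_(size S)} |
      `[< has_square_entry (@word_elt n S N w) >] ]|.

(* Main.v *)
(* The number of words with a square entry is bounded by a large sieve.  If the
   (i,j) entry of g is a square, it is a square modulo every odd prime p, so the
   centred test function tst on F_p^n, evaluated at the column g e_j, is at least
   1/3 for all p in a set P of primes.  The second moment of the sum over P is
   bounded by |P| |S|^N from the diagonal, plus |P|^2 terms that each measure the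
   correlation modulo two distinct primes p, q; these decay exponentially by a
   spectral gap, uniform in p and q, for the action of S on the functions on
   R^n, R = F_p x F_q, that have mean zero and live on unimodular vectors.
   Exponentially many primes are available by Chebyshev's argument.

   The spectral gap is Kazhdan's relative property (T), made elementary.  Freeze
   all coordinates but x_i and x_j: an elementary matrix E_ik translates the
   slice by multiples of z = x_k, while E_ij and E_ji shear it.  On the Fourier
   side, a function almost invariant under E_ik(2) and E_jk(2) has its mass near
   the frequencies killed by z, and a ping-pong argument for the shears shows that
   almost all of it sits exactly there; hence the function is almost invariant
   under E_ik(t) for every t in R.  As random products of such matrices with
   independent t reach all unimodular vectors with comparable probabilities, the
   function is small.  Only the squares E(2), E(4), E(-4) of elementary matrices
   are used, because squares are words of even length in S: this controls
   ||sum_s f o s||^2 directly and rules out eigenvalues near -|S|. *)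
Require Import Defs.
From HB Require Import structures.
From mathcomp Require Import all_boot all_order all_algebra all_field.
From mathcomp Require Import boolp ring lra zify.
Set Implicit Arguments. Unset Strict Implicit. Unset Printing Implicit Defensive.
Import Order.TTheory GRing.Theory Num.Theory.
Local Open Scope ring_scope.

(** * Absolute values of algebraic numbers *)

(* algC is only partially ordered; absolute values are taken in the real field algR. *)
Definition cabs (z : algC) : algR := in_algR (normr_real z).

Lemma cabs_ge0 z : 0 <= cabs z. Proof. exact: (normr_ge0 z). Qed.

Lemma cabsD x y : cabs (x + y) <= cabs x + cabs y.
Proof. exact: (ler_normD x y). Qed.

Lemma cabsM x y : cabs (x * y) = cabs x * cabs y.
Proof. by apply: val_inj; rewrite /= normrM. Qed.

Lemma cabsN x : cabs (- x) = cabs x.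
Proof. by apply: val_inj; rewrite /= normrN. Qed.

Lemma cabsC x y : cabs (x - y) = cabs (y - x).
Proof. by rewrite -cabsN opprB. Qed.

Lemma cabs_eq0 x : (cabs x == 0) = (x == 0).
Proof. by rewrite -val_eqE /= normr_eq0. Qed.

Lemma cabs_nat k : cabs k%:R = k%:R.
Proof. by apply: val_inj; rewrite /= rmorph_nat normr_nat. Qed.

Lemma cabs_real (x : algR) : cabs (algRval x) = `|x|.
Proof. exact: val_inj. Qed.

Lemma cabs_sum (I : Type) (r : seq I) (P : pred I) (F : I -> algC) :
  cabs (\sum_(i <- r | P i) F i) <= \sum_(i <- r | P i) cabs (F i).
Proof.
elim/big_rec2: _ => [|i y x _ H]; first by rewrite (_ : cabs 0 = 0) //; apply/eqP; rewrite cabs_eq0.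
by apply: le_trans (cabsD _ _) _; rewrite lerD2l.
Qed.

(** Factor [u ^+ k - 1] as [u - 1] times the sum of the [u ^+ i], [i < k]: each [u ^+ i] is within
    [i * cabs (u - 1)] of 1, and these errors add up to the binomial term. *)
Lemma cabs_geom (u : algC) k :
  cabs u = 1 -> cabs (u ^+ k - 1) >= (k%:R - 'C(k, 2)%:R * cabs (u - 1)) * cabs (u - 1).
Proof.
move=> u1; have uk j : cabs (u ^+ j - 1) <= j%:R * cabs (u - 1).
  elim: j => [|j IH]; first by rewrite expr0 subrr (eqP (_ : cabs 0 == 0)) ?cabs_eq0 // mul0r.
  rewrite (_ : u ^+ j.+1 - 1 = u * (u ^+ j - 1) + (u - 1)); last by rewrite exprS; ring.
  by apply: le_trans (cabsD _ _) _; rewrite cabsM u1 mul1r -natr1 mulrDl mul1r lerD2r.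
rewrite subrX1 cabsM mulrC ler_wpM2l ?cabs_ge0 //.
have -> : \sum_(i < k) u ^+ i = k%:R + \sum_(i < k) (u ^+ i - 1).
  by rewrite sumrB sumr_const card_ord addrCA subrr addr0.
have H : cabs (\sum_(i < k) (u ^+ i - 1)) <= 'C(k, 2)%:R * cabs (u - 1).
  apply: le_trans (cabs_sum _ _ _) _.
  rewrite -triangular_sum big_mkord natr_sum mulr_suml.
  by apply: ler_sum => i _; apply: uk.
set s := \sum_(i < k) _ in H *.
have: cabs (k%:R + s - s) <= cabs (k%:R + s) + cabs (- s) by apply: cabsD.
by rewrite addrK cabs_nat cabsN => H'; lra.
Qed.

(** * Fourier analysis on a slice *)

Section Fourier.
Variables (R : finComUnitRingType) (e : R -> algC).
Hypothesis e0 : e 0 = 1.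
Hypothesis eD : forall x y, e (x + y) = e x * e y.
Hypothesis e_inj : forall x, e x = 1 -> x = 0.
Hypothesis e_norm : forall x, `|e x| = 1.

Implicit Types (g : R * R -> algC) (k u : R * R).

Definition dot k u := k.1 * u.1 + k.2 * u.2.
Definition ft g k := \sum_u e (dot k u) * g u.
Definition nrm g : algR := \sum_u cabs (g u) ^+ 2.

Lemma eN x : e (- x) = (e x)^*.
Proof.
have h : e x * (e x)^* = 1 by rewrite -normCK e_norm expr1n.
have ex0 : e x != 0 by rewrite -normr_eq0 e_norm oner_eq0.
by apply: (mulfI ex0); rewrite h -eD subrr.
Qed.

(** For [u != 0], faithfulness of [e] gives a frequency [k0] with a nontrivial phase; translating
    the sum by [k0] multiplies it by that phase. *)
Lemma char_orth u : \sum_k e (dot k u) = if u == 0 then (#|R| ^ 2)%:R else 0.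
Proof.
case: eqP => [->|/eqP un0].
  under eq_bigr do rewrite /dot /= !mulr0 addr0 e0.
  by rewrite sumr_const card_prod.
have [k0 hk0] : exists k0, e (dot k0 u) != 1.
  have [u1|u1] := eqVneq u.1 0; last first.
    by exists (1, 0); rewrite /dot /= mul1r mul0r addr0; apply: contraNneq u1 => /e_inj ->.
  exists (0, 1); rewrite /dot /= mul1r mul0r add0r; apply: contraNneq un0 => /e_inj u2.
  by case: (u) u1 u2 => a b /= -> ->.
set T := \sum_k _.
have : T = e (dot k0 u) * T.
  rewrite {1}/T (reindex_inj (addrI k0)) /= mulr_sumr; apply: eq_bigr => k _.
  by rewrite -eD /dot /=; congr (e _); ring.
move/eqP; rewrite -{1}[T]mul1r -subr_eq0 -mulrBl mulf_eq0 subr_eq0 eq_sym (negPf hk0) /=.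
by move/eqP.
Qed.

Lemma parseval g : nrm (ft g) = (#|R| ^ 2)%:R * nrm g.
Proof.
suff: algRval (nrm (ft g)) = algRval ((#|R| ^ 2)%:R * nrm g) by move/val_inj.
rewrite rmorphM rmorph_nat /nrm !rmorph_sum.
under eq_bigr => k _.
  rewrite rmorphXn /= normCK /ft rmorph_sum mulr_suml.
  under eq_bigr => u _ do rewrite mulr_sumr.
  over.
rewrite exchange_big mulr_sumr; apply: eq_bigr => u _.
rewrite exchange_big (bigD1 u) //= [X in _ + X]big1 => [|v vu].
  rewrite addr0 -expr2 normCK.
  transitivity (\sum_(k : R * R) g u * (g u)^*).
    apply: eq_bigr => k _; rewrite rmorphM /= mulrACA.
    by rewrite -normCK e_norm expr1n mul1r.
  by rewrite sumr_const card_prod mulr_natl.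
transitivity (\sum_k (g u * (g v)^*) * e (dot k (u - v))).
  apply: eq_bigr => k _; rewrite rmorphM /= -eN mulrACA -eD mulrC; congr (_ * e _).
  by rewrite /dot /=; ring.
by rewrite -mulr_sumr char_orth subr_eq0 eq_sym (negPf vu) mulr0.
Qed.

Lemma ft_comp g (h h' : R * R -> R * R) k : cancel h h' -> cancel h' h ->
  ft (g \o h) k = \sum_u e (dot k (h' u)) * g u.
Proof.
move=> hK h'K; rewrite /ft (reindex h') /=; last by exists h => u _.
by apply: eq_bigr => u _; rewrite h'K.
Qed.

Lemma ft_shift (w : R * R) g k :
  ft (fun u => g (u + w)) k = e (- dot k w) * ft g k.
Proof.
rewrite (@ft_comp g (+%R^~ w) (+%R^~ (- w))); [|exact: addrK|exact: addrNK].
rewrite mulr_sumr; apply: eq_bigr => u _; rewrite mulrA -eD; congr (e _ * _).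
by rewrite /dot /=; ring.
Qed.

Definition shear1 (c : R) u := (u.1 + c * u.2, u.2).
Definition shear2 (c : R) u := (u.1, u.2 + c * u.1).

Lemma shear1K c : cancel (shear1 c) (shear1 (- c)).
Proof. by case=> a b; rewrite /shear1 /=; congr (_, _); ring. Qed.

Lemma shear2K c : cancel (shear2 c) (shear2 (- c)).
Proof. by case=> a b; rewrite /shear2 /=; congr (_, _); ring. Qed.

Lemma shear1NK c : cancel (shear1 (- c)) (shear1 c).
Proof. by move=> u; have := shear1K (- c) u; rewrite opprK. Qed.

Lemma shear2NK c : cancel (shear2 (- c)) (shear2 c).
Proof. by move=> u; have := shear2K (- c) u; rewrite opprK. Qed.

(** A linear change of variable acts on frequencies by its inverse transpose, which exchanges the
    two kinds of shears. *)
Lemma ft_shear1 c g k : ft (g \o shear1 c) k = ft g (shear2 (- c) k).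
Proof.
rewrite (ft_comp _ _ (shear1K c) (shear1NK c)); apply: eq_bigr => u _.
by congr (e _ * _); rewrite /dot /=; ring.
Qed.

Lemma ft_shear2 c g k : ft (g \o shear2 c) k = ft g (shear1 (- c) k).
Proof.
rewrite (ft_comp _ _ (shear2K c) (shear2NK c)); apply: eq_bigr => u _.
by congr (e _ * _); rewrite /dot /=; ring.
Qed.

Lemma eq_nrm g g' : g =1 g' -> nrm g = nrm g'.
Proof. by move=> gg'; apply: eq_bigr => u _; rewrite gg'. Qed.

Lemma nrm_ge0 g : 0 <= nrm g.
Proof. by apply: sumr_ge0 => u _; rewrite sqr_ge0. Qed.

Lemma parsevalB g1 g2 :
  nrm (fun k => ft g1 k - ft g2 k) = (#|R| ^ 2)%:R * nrm (fun u => g1 u - g2 u).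
Proof.
rewrite -parseval; apply: eq_nrm => k; rewrite /ft -sumrB.
by apply: eq_bigr => u _; rewrite mulrBr.
Qed.

(* lam plays the role of an absolute value on the frequencies: near 0 it grows
   almost linearly under multiplication by 4 and 8. *)
Section PingPong.
Variable lam : R -> algR.
Hypothesis lam_ge0 : forall c, 0 <= lam c.
Hypothesis lamN : forall c, lam (- c) = lam c.
Hypothesis lamD : forall c d, lam (c + d) <= lam c + lam d.
Hypothesis lam4 : forall c, (4 - 6 * lam c) * lam c <= lam (4%:R * c).
Hypothesis lam8 : forall c, (8 - 28 * lam c) * lam c <= lam (8%:R * c).

Definition far k := (1 / 10 <= lam k.1) || (1 / 10 <= lam k.2).
Definition steep k := [&& ~~ far k, 0 < lam k.2 & lam k.1 <= lam k.2].
Definition flat k := [&& ~~ far k, 0 < lam k.1 & lam k.2 <= lam k.1].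

(** Let [y = lam k.2 < 1 / 10]. Then [lam (4%:R * k.2)] is at least 3.4 [y], while steepness of the
    image gives [lam (k.1 + c * k.2) <= y]; so [lam k.1] is at least 2.4 [y]. *)
Lemma steep_shear k c : c = 4%:R \/ c = - 4%:R ->
  steep (shear1 c k) -> flat k || far k.
Proof.
move=> hc; rewrite /steep /flat; case: (boolP (far k)); rewrite ?orbT // orbF /=.
rewrite /far /= !negb_or -!ltNge => /andP[k1 k2] /and3P[/andP[h1 h2] h3 h4].
have : lam (4%:R * k.2) <= lam (k.1 + c * k.2) + lam k.1.
  have -> : lam (4%:R * k.2) = lam (c * k.2) by case: hc => ->; rewrite ?mulNr ?lamN.
  rewrite -[lam k.1]lamN; apply: le_trans (lamD _ _).
  by rewrite (_ : _ - _ = c * k.2) //; ring.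
have := lam4 k.2; move: (lam_ge0 k.1) k1 k2 h1 h2 h3 h4.
move: (lam (4%:R * _)) (lam (_ + _)) (lam k.1) (lam k.2) => a b x y.
by move=> x0 xl yl bl _ y0 by_ h4 h5; apply/andP; split; nra.
Qed.

(** Otherwise [8%:R * k.2], a difference of two elements whose [lam] is at most [lam k.2], would
    have [lam] at most twice [lam k.2], against at least 5.2 times by [lam8]. *)
Lemma steep_disjoint k : ~~ (steep (shear1 4%:R k) && steep (shear1 (- 4%:R) k)).
Proof.
apply/negP => /andP[/and3P[f1 p1 s1] /and3P[f2 _ s2]].
move: f1 s1 s2 p1; rewrite /far /= negb_or -!ltNge => /andP[_ h2] s1 s2 p1.
have : lam (8%:R * k.2) <= lam (k.1 + 4%:R * k.2) + lam (k.1 + - 4%:R * k.2).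
  rewrite -[lam (_ + - _ * _)]lamN; apply: le_trans (lamD _ _).
  rewrite (_ : _ - _ = 8%:R * k.2) // mulNr.
  by rewrite (_ : 8%:R = 4%:R + 4%:R :> R) -?natrD //; ring.
have := lam8 k.2; nra.
Qed.

Definition mass (P : pred (R * R)) g : algR := \sum_(k | P k) cabs (g k) ^+ 2.

(* Uses x^2 <= 3/2 y^2 + 3 d^2 whenever 0 <= x <= y + d. *)
Lemma mass_shear c g P :
  mass P g <= 3 / 2 * mass (P \o shear1 (- c)) g
              + 3 * nrm (fun k => g (shear1 c k) - g k).
Proof.
have -> : mass (P \o shear1 (- c)) g = \sum_(k | P k) cabs (g (shear1 c k)) ^+ 2.
  rewrite /mass (reindex (shear1 c)) /=; last first.
    by exists (shear1 (- c)) => u _; rewrite (shear1K, shear1NK).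
  by apply: eq_bigl => k; rewrite /= shear1K.
rewrite /mass /nrm !mulr_sumr.
rewrite [X in _ <= _ + X](bigID P) /= addrA -big_split /=.
rewrite -[leLHS]addr0 lerD //; last first.
  by apply: sumr_ge0 => k _; rewrite mulr_ge0 ?sqr_ge0.
apply: ler_sum => k _.
have := cabsD (g (shear1 c k)) (g k - g (shear1 c k)); rewrite [X in cabs X <= _]addrC subrK cabsC.
move: (cabs_ge0 (g k)) (cabs_ge0 (g (shear1 c k))) (cabs_ge0 (g (shear1 c k) - g k)).
move: (cabs _) (cabs _) (cabs _) => d y x x0 y0 d0 xyd.
have : x ^+ 2 <= (y + d) ^+ 2 by apply: lerXn2r; rewrite ?nnegrE ?addr_ge0.
have : 0 <= (y - 2 * d) ^+ 2 by apply: sqr_ge0.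
nra.
Qed.

Lemma mass_ge0 P g : 0 <= mass P g.
Proof. by apply: sumr_ge0 => k _; rewrite sqr_ge0. Qed.

(** The preimages of the steep region under the two shears are disjoint and lie in the flat and far
    regions. The gain is 2 against 3 / 2: adding the same bound with coordinates swapped controls
    both the steep and the flat mass. *)
Lemma mass_steep g :
  2 * mass steep g <= 3 / 2 * (mass flat g + mass far g)
     + 3 * (nrm (fun k => g (shear1 4%:R k) - g k)
            + nrm (fun k => g (shear1 (- 4%:R) k) - g k)).
Proof.
have := mass_shear 4%:R g steep; have := mass_shear (- 4%:R) g steep.
have : mass (steep \o shear1 (- 4%:R)) g + mass (steep \o shear1 (- - 4%:R)) g
   <= mass flat g + mass far g.
  rewrite /mass [X in X + _]big_mkcond [X in _ + X <= _]big_mkcond.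
  rewrite [X in _ <= X + _]big_mkcond [X in _ <= _ + X]big_mkcond -!big_split /=.
  apply: ler_sum => k _; rewrite opprK.
  have := steep_disjoint k.
  have := @steep_shear k 4%:R (or_introl erefl).
  have := @steep_shear k (- 4%:R) (or_intror erefl).
  have := sqr_ge0 (cabs (g k)); move: (_ ^+ 2) => x x0.
  case: (steep (shear1 (- 4%:R) k)); case: (steep (shear1 4%:R k));
    case: (flat k); case: (far k) => //= h1 h2 h3; try (by have := h1 isT);
    try (by have := h2 isT); lra.
lra.
Qed.

End PingPong.

Definition swap k := (k.2, k.1).

Lemma swapK : involutive swap. Proof. by case. Qed.

Lemma nrm_swap g : nrm (g \o swap) = nrm g.
Proof. by rewrite /nrm [RHS](reindex_inj (can_inj swapK)). Qed.

Section Slice.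
Hypothesis two_unit : (2%:R : R) \is a GRing.unit.
Variable z : R.

(** Translating a slice by [2%:R * z] along an axis multiplies each Fourier coefficient by a phase;
    [lam] is the distance of this phase from 1, up to the sign of [c]. *)
Definition lam c := cabs (e (2%:R * z * c) - 1).

Lemma cabs_e x : cabs (e x) = 1.
Proof. by apply: val_inj; rewrite /= e_norm. Qed.

Lemma eMn x m : e (x *+ m) = e x ^+ m.
Proof. by elim: m => [|m IH]; rewrite ?mulr0n // mulrS exprS eD IH. Qed.

Lemma lamN c : lam (- c) = lam c.
Proof.
rewrite /lam mulrN -[RHS]mul1r -(cabs_e (- (2%:R * z * c))) -cabsM mulrBr mulr1.
by rewrite -eD addNr e0 cabsC.
Qed.

Lemma lamD c d : lam (c + d) <= lam c + lam d.
Proof.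
rewrite /lam mulrDr eD -[X in _ <= _ + X]mul1r -(cabs_e (2%:R * z * c)) -cabsM.
rewrite [leRHS]addrC; apply: le_trans (cabsD _ _).
rewrite (_ : _ * _ - 1 =
  e (2%:R * z * c) * (e (2%:R * z * d) - 1) + (e (2%:R * z * c) - 1)) //; ring.
Qed.

Lemma lamMn m c : (m%:R - 'C(m, 2)%:R * lam c) * lam c <= lam (m%:R * c).
Proof.
rewrite /lam (_ : 2%:R * z * (m%:R * c) = (2%:R * z * c) *+ m); last by rewrite -mulr_natl; ring.
by rewrite eMn; apply: cabs_geom; apply: cabs_e.
Qed.

Lemma far_swap k : far lam (swap k) = far lam k.
Proof. by rewrite /far orbC. Qed.

Lemma steep_swap k : steep lam (swap k) = flat lam k.
Proof. by rewrite /steep far_swap. Qed.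

Lemma flat_swap k : flat lam (swap k) = steep lam k.
Proof. by rewrite /flat far_swap. Qed.

Lemma mass_swap P P' g : (forall k, P (swap k) = P' k) -> mass P (g \o swap) = mass P' g.
Proof.
move=> PP'; rewrite /mass (reindex_inj (can_inj swapK)) /=.
by apply: eq_big => k; rewrite ?PP' //= swapK.
Qed.

Definition sd g (h : R * R -> R * R) := nrm (fun u => g (h u) - g u).

Lemma sd_ge0 g h : 0 <= sd g h. Proof. exact: nrm_ge0. Qed.

Lemma relative_T_slice (C : algR) g t : 3000%:R <= C ->
  sd g (+%R^~ (t * z, 0)) <= C *
    (sd g (+%R^~ (2%:R * z, 0)) + sd g (+%R^~ (0, 2%:R * z))
     + sd g (shear1 4%:R) + sd g (shear1 (- 4%:R))
     + sd g (shear2 4%:R) + sd g (shear2 (- 4%:R))).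
Proof.
move=> C3000; apply: (@le_trans _ _ (3000%:R *
    (sd g (+%R^~ (2%:R * z, 0)) + sd g (+%R^~ (0, 2%:R * z))
     + sd g (shear1 4%:R) + sd g (shear1 (- 4%:R))
     + sd g (shear2 4%:R) + sd g (shear2 (- 4%:R))))); last first.
  by apply: ler_wpM2r => //; rewrite !addr_ge0 ?sd_ge0.
set N : algR := (#|R| ^ 2)%:R.
have N0 : 0 < N by rewrite ltr0n expn_gt0; apply/orP; left; apply/card_gt0P; exists 0.
rewrite -(ler_pM2l N0) mulrCA !mulrDr.
have shift w : N * sd g (+%R^~ w) = \sum_k cabs (e (- dot k w) - 1) ^+ 2 * cabs (ft g k) ^+ 2.
  rewrite /sd -(parsevalB (fun u => g (u + w))); apply: eq_bigr => k _.
  by rewrite ft_shift -exprMn -cabsM mulrBl mul1r.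
have sh1 c : N * sd g (shear1 c) = nrm (fun k => ft g (shear2 (- c) k) - ft g k).
  by rewrite /sd -(parsevalB (g \o shear1 c)); apply: eq_nrm => k; rewrite ft_shear1.
have sh2 c : N * sd g (shear2 c) = nrm (fun k => ft g (shear1 (- c) k) - ft g k).
  by rewrite /sd -(parsevalB (g \o shear2 c)); apply: eq_nrm => k; rewrite ft_shear2.
have lam0 c : 0 <= lam c by apply: cabs_ge0.
(* The swap exchanges [steep] with [flat] and the two kinds of shears, so the second instance bounds
   the flat mass. *)
have := mass_steep lam0 lamN lamD (lamMn 4) (lamMn 8) (ft g).
have := mass_steep lam0 lamN lamD (lamMn 4) (lamMn 8) (ft g \o swap).
rewrite (mass_swap _ steep_swap) (mass_swap _ flat_swap) (mass_swap _ far_swap).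
have sw c : nrm (fun k => (ft g \o swap) (shear1 c k) - (ft g \o swap) k)
    = nrm (fun k => ft g (shear2 c k) - ft g k).
  by rewrite -nrm_swap; apply: eq_nrm; case.
rewrite !sw !sh1 !sh2 opprK.
(* The factor 100 is the inverse square of the threshold 1 / 10 in [far]. *)
have : mass (far lam) (ft g) <=
    100%:R * (N * sd g (+%R^~ (2%:R * z, 0)) + N * sd g (+%R^~ (0, 2%:R * z))).
  rewrite !shift -big_split mulr_sumr /mass big_mkcond; apply: ler_sum => k _ /=.
  have -> : e (- dot k (2%:R * z, 0)) = e (2%:R * z * - k.1) by congr e; rewrite /dot /=; ring.
  have -> : e (- dot k (0, 2%:R * z)) = e (2%:R * z * - k.2) by congr e; rewrite /dot /=; ring.
  rewrite -!/(lam _) !lamN -mulrDl mulrA.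
  have x0 := sqr_ge0 (cabs (ft g k)).
  case: ifP => [|_]; last first.
    by apply: mulr_ge0 => //; apply: mulr_ge0; rewrite ?ler0n // addr_ge0 ?sqr_ge0.
  move=> fk; rewrite -[leLHS]mul1r ler_wpM2r //.
  have := lam0 k.1; have := lam0 k.2.
  by case/orP: fk => ?; nra.
have : N * sd g (+%R^~ (t * z, 0)) <=
    4 * (mass (steep lam) (ft g) + mass (flat lam) (ft g) + mass (far lam) (ft g)).
  rewrite shift /mass [X in 4 * (X + _ + _)]big_mkcond [X in 4 * (_ + X + _)]big_mkcond.
  rewrite [X in 4 * (_ + _ + X)]big_mkcond -!big_split mulr_sumr; apply: ler_sum => k _ /=.
  set x := cabs (ft g k) ^+ 2; have x0 : 0 <= x by apply: sqr_ge0.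
  have d4 : cabs (e (- dot k (t * z, 0)) - 1) ^+ 2 <= 4.
    have := cabsD (e (- dot k (t * z, 0))) (- 1); rewrite cabsN cabs_e (cabs_nat 1).
    by have := cabs_ge0 (e (- dot k (t * z, 0)) - 1); nra.
  have d4x : cabs (e (- dot k (t * z, 0)) - 1) ^+ 2 * x <= 4 * x by rewrite ler_wpM2r.
  case: (boolP (steep lam k)) => sk.
    by case: (flat lam k); case: (far lam k); lra.
  case: (boolP (flat lam k)) => flk; first by case: (far lam k); lra.
  case: (boolP (far lam k)) => fk; first by lra.
  (* A frequency in none of the three regions has [lam] zero in both coordinates. Faithfulness of
     [e] then gives [z * k.1 = 0], so translation by any multiple of [z] fixes this Fourier
     coefficient. *)
  suff l1 : lam k.1 = 0.
    move/eqP: l1; rewrite /lam cabs_eq0 subr_eq0 => /eqP/e_inj h.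
    have zk : z * k.1 = 0.
      by apply: (mulrI two_unit); rewrite mulrA h mulr0.
    rewrite (_ : dot k _ = 0) ?oppr0 ?e0 ?subrr; last first.
      by rewrite /dot /= mulr0 addr0 mulrCA [k.1 * z]mulrC zk mulr0.
    by rewrite (eqP (_ : cabs 0 == 0)) ?cabs_eq0 // expr0n /= mul0r !addr0 mulr0.
  move: sk flk; rewrite /steep /flat fk /= !negb_and -!ltNge -!leNgt.
  by have := lam0 k.1; have := lam0 k.2; move=> ? ? /orP[?|?] /orP[?|?]; lra.
have nsd h : 0 <= N * sd g h by rewrite mulr_ge0 ?sd_ge0 ?ltW.
(* The two ping-pong bounds give steep + flat at most 6 far + 6 times the shear terms. Hence 4
   (steep + flat + far) is at most 28 far + 24 times the shear terms, and 28 * 100 is below 3000. *)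
have := mass_ge0 (steep lam) (ft g); have := mass_ge0 (flat lam) (ft g).
have := mass_ge0 (far lam) (ft g).
have := nsd (+%R^~ (2%:R * z, 0)); have := nsd (+%R^~ (0, 2%:R * z)).
have := nsd (shear1 4%:R); have := nsd (shear1 (- 4%:R)).
have := nsd (shear2 4%:R); have := nsd (shear2 (- 4%:R)).
rewrite !sh1 !sh2 !opprK; move: (nrm _) (nrm _) (nrm _) (nrm _).
move: (N * _) (N * _) (N * _).
move: (mass _ _) (mass _ _) (mass _ _) => *.
lra.
Qed.

End Slice.
End Fourier.

(** * Elementary matrices and relative property (T) on column vectors *)

Definition elem (R : pzRingType) n (i j : 'I_n) (t : R) : 'M[R]_n :=
  1%:M + t *: delta_mx i j.

Lemma elemE (R : pzRingType) n (i j : 'I_n) (t : R) (v : 'cV[R]_n) l :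
  (elem i j t *m v) l 0 = v l 0 + (if l == i then t * v j 0 else 0).
Proof.
rewrite /elem mulmxDl mul1mx -scalemxAl !mxE; congr (_ + _).
rewrite (bigD1 j) //= big1 => [|k kj]; last by rewrite mxE (negPf kj) andbF mul0r.
by rewrite mxE eqxx andbT addr0; case: eqP => _; rewrite ?mul1r ?mul0r ?mulr0.
Qed.

Definition disp (R : finComUnitRingType) n (f : 'cV[R]_n -> algR) (A : 'M[R]_n) : algR :=
  \sum_v (f (A *m v) - f v) ^+ 2.

Section Slices.
Variables (R : finComUnitRingType) (n : nat) (i j : 'I_n).
Hypothesis ij : i != j.

Definition set2 (v : 'cV[R]_n) (u : R * R) : 'cV[R]_n :=
  \col_l (if l == i then u.1 else if l == j then u.2 else v l 0).

(** Summing over all [v], although its coordinates [i] and [j] are overwritten, avoids choosing one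
    base point per slice; the price is the multiplicity [#|R| ^ 2]. *)
Lemma sum_set2 (T : nmodType) (F : 'cV[R]_n -> T) :
  \sum_v \sum_u F (set2 v u) = (\sum_v F v) *+ (#|R| ^ 2).
Proof.
transitivity (\sum_v \sum_(u : R * R) F (v + u.1 *: delta_mx i 0 + u.2 *: delta_mx j 0)).
  apply: eq_bigr => v _; rewrite (reindex_inj (addrI (v i 0, v j 0))) /=.
  apply: eq_bigr => u _; congr F; apply/colP => l; rewrite !mxE eqxx !andbT.
  have [->|li] := eqVneq l i; first by rewrite (negPf ij) mulr1 mulr0 addr0.
  by have [->|lj] := eqVneq l j; rewrite ?mulr0 ?mulr1 ?addr0.
rewrite exchange_big /= (eq_bigr (fun=> \sum_v F v)) => [|u _].
  by rewrite sumr_const card_prod.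
rewrite [RHS](reindex_inj (addIr (u.1 *: delta_mx i 0 + u.2 *: delta_mx j 0))) /=.
by apply: eq_bigr => v _; rewrite addrA.
Qed.

Lemma disp_slices (f : 'cV[R]_n -> algR) (A : 'M[R]_n) (h : 'cV[R]_n -> R * R -> R * R) :
  (forall v u, A *m set2 v u = set2 v (h v u)) ->
  (#|R| ^ 2)%:R * disp f A = \sum_v sd (fun u => algRval (f (set2 v u))) (h v).
Proof.
move=> hA; rewrite mulr_natl -sum_set2; apply: eq_bigr => v _.
apply: eq_bigr => u _; rewrite hA -rmorphB cabs_real.
by rewrite real_normK // num_real.
Qed.

End Slices.

(** Since [k] differs from [i] and [j], the coordinate [z = v k 0] is constant on each slice. The
    slice inequality holds with a constant independent of [z], so it can be summed over slices. *)
Lemma relative_T (R : finComUnitRingType) (e : R -> algC) n (i j k : 'I_n)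
    (f : 'cV[R]_n -> algR) (t : R) (C : algR) : 3000%:R <= C ->
  e 0 = 1 -> (forall x y, e (x + y) = e x * e y) -> (forall x, e x = 1 -> x = 0) ->
  (forall x, `|e x| = 1) -> (2%:R : R) \is a GRing.unit ->
  i != j -> i != k -> j != k ->
  disp f (elem i k t) <= C *
    (disp f (elem i k 2%:R) + disp f (elem j k 2%:R)
     + disp f (elem i j 4%:R) + disp f (elem i j (- 4%:R))
     + disp f (elem j i 4%:R) + disp f (elem j i (- 4%:R))).
Proof.
move=> C3000 e0 eD e_inj e_norm two ij ik jk.
have hik (s : R) v u : elem i k s *m set2 i j v u = set2 i j v (u + (s * v k 0, 0)).
  apply/colP => l; rewrite elemE !mxE ![k == _]eq_sym (negPf ik) (negPf jk).
  have [//|li] := eqVneq l i; have [//|lj] := eqVneq l j; rewrite /= ?addr0 //.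
have hjk (s : R) v u : elem j k s *m set2 i j v u = set2 i j v (u + (0, s * v k 0)).
  apply/colP => l; rewrite elemE !mxE ![k == _]eq_sym (negPf ik) (negPf jk).
  have [->|li] := eqVneq l i; first by rewrite (negPf ij) /= !addr0.
  by have [//|lj] := eqVneq l j; rewrite /= ?addr0.
have hij (s : R) v u : elem i j s *m set2 i j v u = set2 i j v (shear1 s u).
  apply/colP => l; rewrite elemE !mxE eqxx [j == i]eq_sym (negPf ij).
  have [//|li] := eqVneq l i; have [//|lj] := eqVneq l j; rewrite /= ?addr0 //.
have hji (s : R) v u : elem j i s *m set2 i j v u = set2 i j v (shear2 s u).
  apply/colP => l; rewrite elemE !mxE eqxx.
  have [->|li] := eqVneq l i; first by rewrite (negPf ij) /= !addr0.
  by have [//|lj] := eqVneq l j; rewrite /= ?addr0.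
have dik s := disp_slices ij f (hik s); have djk s := disp_slices ij f (hjk s).
have dij s := disp_slices ij f (hij s); have dji s := disp_slices ij f (hji s).
have : 0 < (#|R| ^ 2)%:R :> algR.
  by rewrite ltr0n expn_gt0; apply/orP; left; apply/card_gt0P; exists 0.
move: (_%:R) dik djk dij dji => N dik djk dij dji N0.
rewrite -(ler_pM2l N0) mulrCA !(mulrDr N) (dik t) (dik 2%:R) (djk 2%:R).
rewrite (dij 4%:R) (dij (- 4%:R)) (dji 4%:R) (dji (- 4%:R)).
rewrite -!big_split mulr_sumr; apply: ler_sum => v _.
exact: (relative_T_slice e0 eD e_inj e_norm two (v k 0)
  (fun u => algRval (f (set2 i j v u))) t C3000).
Qed.

(** * Mixing by unipotent matrices *)

(** Translations of [Y] lift to translations of [X], so [h] has fibres of equal size. The proof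
    averages over all translates. *)
Lemma fiber_sum (X Y : finZmodType) (h : X -> Y) (G : Y -> algR) :
  (forall c, exists d, forall x, h (x + d) = h x + c) ->
  #|Y|%:R * \sum_x G (h x) = #|X|%:R * \sum_y G y.
Proof.
move=> hd; rewrite !mulr_natl -!sumr_const.
transitivity (\sum_(c : Y) \sum_x G (h x + c)).
  apply: eq_bigr => c _; have [d hdc] := hd c.
  by rewrite (reindex_inj (addIr d)); apply: eq_bigr => x _; rewrite hdc.
rewrite exchange_big /=; apply: eq_bigr => x _.
by rewrite [RHS](reindex_inj (addrI (h x))).
Qed.

Definition dotc (R : pzRingType) m (t y : 'cV[R]_m) : R := \sum_j t j 0 * y j 0.

Lemma dotcDl (R : pzRingType) m (t t' y : 'cV[R]_m) :
  dotc (t + t') y = dotc t y + dotc t' y.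
Proof. by rewrite -big_split; apply: eq_bigr => j _; rewrite mxE mulrDl. Qed.

Lemma dotcZl (R : pzRingType) m c (t y : 'cV[R]_m) : dotc (c *: t) y = c * dotc t y.
Proof. by rewrite mulr_sumr; apply: eq_bigr => j _; rewrite mxE mulrA. Qed.

Lemma dotc_delta (R : pzRingType) m (j : 'I_m) (y : 'cV[R]_m) : dotc (delta_mx j 0) y = y j 0.
Proof.
rewrite /dotc (bigD1 j) //= big1 => [|k kj]; first by rewrite mxE !eqxx mul1r addr0.
by rewrite mxE (negPf kj) mul0r.
Qed.

Definition vanish (R : nzRingType) (F : fieldType) (pi : R -> F) m (v : 'cV[R]_m) :=
  [forall l, pi (v l 0) == 0].

Definition vec (R : nzRingType) m (a : R) (y : 'cV[R]_m) : 'cV[R]_m.+1 :=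
  \col_l (if unlift ord0 l is Some j then y j 0 else a).

Lemma vec0 (R : nzRingType) m (a : R) (y : 'cV[R]_m) : vec a y ord0 0 = a.
Proof. by rewrite mxE unlift_none. Qed.

Lemma vecS (R : nzRingType) m (a : R) (y : 'cV[R]_m) j : vec a y (lift ord0 j) 0 = y j 0.
Proof. by rewrite mxE liftK. Qed.

Lemma vecP (R : nzRingType) m (v : 'cV[R]_m.+1) :
  v = vec (v ord0 0) (\col_j v (lift ord0 j) 0).
Proof.
by apply/colP => l; rewrite mxE; case: unliftP => [j|] ->; rewrite ?mxE.
Qed.

Lemma sum_vec (R : finNzRingType) (T : nmodType) m (G : 'cV[R]_m.+1 -> T) (P : pred 'cV[R]_m.+1) :
  \sum_(v | P v) G v = \sum_a \sum_(y | P (vec a y)) G (vec a y).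
Proof.
rewrite pair_big_dep /=.
rewrite (reindex (fun p : R * 'cV[R]_m => vec p.1 p.2)) //=.
exists (fun v => (v ord0 0, \col_j v (lift ord0 j) 0)) => [[a y]|v] _ /=.
  by rewrite vec0; congr (_, _); apply/colP => j; rewrite mxE vecS.
by rewrite -vecP.
Qed.

Lemma vanish_vec (R : nzRingType) (F : fieldType) (pi : R -> F) m a (y : 'cV[R]_m) :
  vanish pi (vec a y) = (pi a == 0) && vanish pi y.
Proof.
apply/forallP/andP => [h|[/eqP ha /forallP hy] l].
  split; first by have := h ord0; rewrite vec0.
  by apply/forallP => j; have := h (lift ord0 j); rewrite vecS.
by rewrite mxE; case: unliftP => [j|] _; rewrite ?ha ?hy.
Qed.

Section Projection.
Variables (R : finComUnitRingType) (F : finFieldType) (pi : {rmorphism R -> F}).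
Hypothesis pi_surj : forall c, exists x, pi x = c.
Hypothesis F3 : (3 <= #|F|)%N.

Lemma fiber_bound (X : finZmodType) (h : X -> F) :
  (forall c, exists d, forall x, h (x + d) = h x + c) ->
  3 * \sum_x (h x == 0)%:R <= #|X|%:R :> algR.
Proof.
move=> hd; have := fiber_sum (fun c => (c == 0)%:R) hd.
rewrite [X in _ = _ * X](bigD1 0) //= [X in _ = _ * (_ + X)]big1 => [|c /negPf -> //].
rewrite eqxx addr0 mulr1 => <-.
apply: ler_wpM2r; last by rewrite ler_nat.
by apply: sumr_ge0 => x _; rewrite ler0n.
Qed.

(** If [y] is nonzero under [pi], the affine form is equidistributed in [F]; otherwise its image is
    the constant [pi a], which is nonzero. *)
Lemma affine_zero_bound m a (y : 'cV[R]_m) : ~~ vanish pi (vec a y) ->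
  3 * \sum_(t : 'cV[R]_m) (pi (a + dotc t y) == 0)%:R <= #|{: 'cV[R]_m}|%:R :> algR.
Proof.
rewrite vanish_vec negb_and; case: (boolP (vanish pi y)) => [/forallP y0|].
  rewrite orbF => a0; rewrite big1 ?mulr0 ?ler0n // => t _.
  rewrite rmorphD rmorph_sum big1 ?addr0 ?(negPf a0) // => j _.
  by rewrite rmorphM (eqP (y0 j)) mulr0.
rewrite negb_forall => /existsP[j yj] _.
apply: fiber_bound => c; have [x xc] := pi_surj (c / pi (y j 0)).
exists (x *: delta_mx j 0) => t; rewrite dotcDl dotcZl dotc_delta addrA rmorphD.
by rewrite rmorphM xc mulfVK.
Qed.

(** If [pi b = 0], the image of [z - b *: s] is that of [z], which is nonzero. Otherwise its first
    coordinate is already equidistributed. *)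
Lemma line_vanish_bound m b (z : 'cV[R]_m.+1) : ~~ vanish pi (vec b z) ->
  3 * \sum_(s : 'cV[R]_m.+1) (vanish pi (z - b *: s))%:R <= #|{: 'cV[R]_m.+1}|%:R :> algR.
Proof.
rewrite vanish_vec negb_and.
have [b0 /= z0|b0 _] := eqVneq (pi b) 0.
  rewrite big1 ?mulr0 ?ler0n // => s _; apply/eqP; rewrite pnatr_eq0 eqb0.
  apply: contra z0 => /forallP h; apply/forallP => l; have := h l.
  by rewrite !mxE rmorphB rmorphM b0 mul0r subr0.
apply: (@le_trans _ _ (3 * \sum_(s : 'cV[R]_m.+1) (pi (z ord0 0 - b * s ord0 0) == 0)%:R)).
  apply: ler_wpM2l => //; apply: ler_sum => s _; rewrite ler_nat.
  by case: (boolP (vanish pi _)) => //= /forallP/(_ ord0); rewrite !mxE => ->.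
apply: fiber_bound => c; have [x xc] := pi_surj (- c / pi b).
exists (x *: delta_mx ord0 0) => s; rewrite !mxE !eqxx mulr1 mulrDr opprD addrA rmorphB.
by rewrite rmorphM xc [pi b * _]mulrC mulfVK // opprK.
Qed.

Lemma vanish_bound m :
  3 * \sum_(v : 'cV[R]_m.+1) (vanish pi v)%:R <= #|{: 'cV[R]_m.+1}|%:R :> algR.
Proof.
apply: (@le_trans _ _ (3 * \sum_(v : 'cV[R]_m.+1) (pi (v ord0 0) == 0)%:R)).
  apply: ler_wpM2l => //; apply: ler_sum => s _; rewrite ler_nat.
  by case: (boolP (vanish pi _)) => //= /forallP/(_ ord0) ->.
apply: fiber_bound => c; have [x xc] := pi_surj c.
by exists (x *: delta_mx ord0 0) => s; rewrite !mxE !eqxx mulr1 rmorphD xc.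
Qed.

End Projection.

Lemma elem_mul_delta (R : comNzRingType) n (i j k l : 'I_n) (t : R) : j != k ->
  elem i j t *m delta_mx k l = delta_mx k l.
Proof.
move=> jk; rewrite /elem mulmxDl mul1mx -scalemxAl mul_delta_mx_0 //.
by rewrite scaler0 addr0.
Qed.

Lemma elemM (R : comNzRingType) n (i j : 'I_n) (c d : R) : i != j ->
  elem i j c *m elem i j d = elem i j (c + d).
Proof.
move=> ij; rewrite {2}/elem mulmxDr mulmx1 -scalemxAr elem_mul_delta 1?eq_sym //.
by rewrite /elem -addrA -scalerDl.
Qed.

Section Unipotent.
Variables (R : finComUnitRingType) (n : nat).
Implicit Types (f : 'cV[R]_n -> algR) (A B : 'M[R]_n).

Lemma sum_unitmx (T : nmodType) (G : 'cV[R]_n -> T) A :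
  A \in unitmx -> \sum_v G (A *m v) = \sum_v G v.
Proof.
move=> Au; rewrite [RHS](reindex (mulmx A)) //=.
by exists (mulmx (invmx A)) => v _; rewrite ?mulKmx ?mulKVmx.
Qed.

Lemma disp_mul f A B : B \in unitmx ->
  disp f (A *m B) <= 2 * disp f A + 2 * disp f B.
Proof.
move=> Bu; rewrite /disp -(sum_unitmx (fun v => (f (A *m v) - f v) ^+ 2) Bu).
rewrite !mulr_sumr -big_split; apply: ler_sum => v _ /=; rewrite mulmxA.
move: (f (A *m B *m v)) (f (B *m v)) (f v) => a b c.
by have := sqr_ge0 (a - b - (b - c)); nra.
Qed.

Lemma disp1 f : disp f 1%:M = 0.
Proof. by rewrite /disp big1 // => v _; rewrite mul1mx subrr expr0n. Qed.

Lemma elem_unit (i j : 'I_n) (t : R) : i != j -> elem i j t \in unitmx.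
Proof.
move=> ij; suff /mulmx1_unit[] : elem i j t *m elem i j (- t) = 1%:M by [].
by rewrite elemM // subrr /elem scale0r addr0.
Qed.

Definition unip (c : 'I_n * 'I_n -> R) (r : seq ('I_n * 'I_n)) : 'M[R]_n :=
  1%:M + \sum_(p <- r) c p *: delta_mx p.1 p.2.

Lemma unip_cons c p r : all (fun q => p.2 != q.1) r ->
  unip c (p :: r) = elem p.1 p.2 (c p) *m unip c r.
Proof.
move=> pr; rewrite /unip big_cons mulmxDr mulmx1 mulmx_sumr addrA; congr (_ + _).
apply: eq_big_seq => q qr.
by rewrite -scalemxAr elem_mul_delta //; apply: (allP pr).
Qed.

(** No column index of [r] is a row index, so the product of the elementary matrices is [unip c r].
    Each factor costs at most 4, because [2 * D + 2 * x * D <= 4 * x * D] for [x >= 1]. *)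
Lemma disp_unip f (D : algR) c r : 0 <= D ->
  (forall i j t, i != j -> disp f (elem i j t) <= D) ->
  allrel (fun p q => p.2 != q.1) r r ->
  unip c r \in unitmx /\ disp f (unip c r) <= (4 ^ size r)%:R * D.
Proof.
move=> D0 fD; elim: r => [|p r IH].
  by rewrite /unip big_nil addr0 unitmx1 disp1 mul1r.
rewrite allrel_cons2 => /and4P[pp pr _ /IH[ru IHr]]; rewrite unip_cons //.
rewrite eq_sym in pp; split; first by rewrite unitmx_mul ru elem_unit.
apply: le_trans (disp_mul _ _ ru) _; have := fD _ _ (c p) pp.
have : 1 <= (4 ^ size r)%:R :> algR by rewrite ler1n expn_gt0.
rewrite /= expnS natrM; move: (_%:R) IHr => x; nra.
Qed.

Lemma unipE c r (v : 'cV[R]_n) l :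
  (unip c r *m v) l 0 = v l 0 + \sum_(p <- r | p.1 == l) c p * v p.2 0.
Proof.
rewrite /unip mulmxDl mul1mx mxE; congr (_ + _).
rewrite mulmx_suml summxE [RHS]big_mkcond; apply: eq_bigr => p _.
rewrite -scalemxAl !mxE (bigD1 p.2) //= big1 => [|k kp]; last first.
  by rewrite mxE (negPf kp) andbF mul0r.
by rewrite mxE eqxx andbT addr0 eq_sym; case: eqP; rewrite ?mul1r ?mul0r ?mulr0.
Qed.

End Unipotent.

Section Doeblin.
Variables (R : finComUnitRingType) (m : nat).

Definition rowU (t : 'cV[R]_m) : 'M[R]_m.+1 :=
  unip (fun p => if unlift ord0 p.2 is Some j then t j 0 else 0)
       [seq (ord0, lift ord0 j) | j <- enum 'I_m].

Definition colL (s : 'cV[R]_m) : 'M[R]_m.+1 :=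
  unip (fun p => if unlift ord0 p.1 is Some j then s j 0 else 0)
       [seq (lift ord0 j, ord0) | j <- enum 'I_m].

Lemma rowUE t a y : rowU t *m vec a y = vec (a + dotc t y) y.
Proof.
apply/colP => l; rewrite unipE big_map; case: (unliftP ord0 l) => [j|] ->.
  by rewrite big_pred0 ?addr0 ?vecS.
rewrite !vec0 /dotc big_enum /=; congr (_ + _).
by apply: eq_bigr => j _; rewrite liftK vecS.
Qed.

Lemma colLE s a y : colL s *m vec a y = vec a (y + a *: s).
Proof.
apply/colP => l; rewrite unipE big_map big_enum_cond; case: (unliftP ord0 l) => [j|] ->.
  rewrite !vecS (big_pred1 j) => [|k]; first by rewrite liftK vec0 !mxE mulrC.
  by rewrite /= (inj_eq lift_inj).
by rewrite big_pred0 ?addr0 ?vec0.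
Qed.

Lemma disp_rowU (f : 'cV[R]_m.+1 -> algR) (D : algR) t : 0 <= D ->
  (forall i j t, i != j -> disp f (elem i j t) <= D) ->
  rowU t \in unitmx /\ disp f (rowU t) <= (4 ^ m)%:R * D.
Proof.
move=> D0 fD; rewrite -[X in (4 ^ X)%N](size_enum_ord m).
rewrite -(size_map (fun j => (ord0, lift ord0 j) : 'I_m.+1 * 'I_m.+1)).
by apply: disp_unip => //; apply/allrelP => p q /mapP[j _ ->] /mapP[k _ ->].
Qed.

Lemma disp_colL (f : 'cV[R]_m.+1 -> algR) (D : algR) s : 0 <= D ->
  (forall i j t, i != j -> disp f (elem i j t) <= D) ->
  colL s \in unitmx /\ disp f (colL s) <= (4 ^ m)%:R * D.
Proof.
move=> D0 fD; rewrite -[X in (4 ^ X)%N](size_enum_ord m).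
rewrite -(size_map (fun j => (lift ord0 j, ord0) : 'I_m.+1 * 'I_m.+1)).
by apply: disp_unip => //; apply/allrelP => p q /mapP[j _ ->] /mapP[k _ ->].
Qed.

End Doeblin.

(** * Unimodular vectors over a product of two finite fields *)

HB.instance Definition _ (R1 R2 : finComUnitRingType) :=
  GRing.ComUnitRing.on (R1 * R2)%type.

Section ProductOfFields.
Variables (F1 F2 : finFieldType).
Hypothesis F1_3 : (3 <= #|F1|)%N.
Hypothesis F2_3 : (3 <= #|F2|)%N.
Notation R := (F1 * F2)%type.

(* Unimodular vectors: nonzero modulo both factors. *)
Definition um m (v : 'cV[R]_m) := ~~ vanish fst v && ~~ vanish snd v.

Let fst_surj (c : F1) : exists x : R, x.1 = c. Proof. by exists (c, 0). Qed.
Let snd_surj (c : F2) : exists x : R, x.2 = c. Proof. by exists (0, c). Qed.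

(** Invert one nonzero coordinate in each factor and glue the two solutions by the idempotents (1,
    0) and (0, 1). *)
Lemma um_dot m (y : 'cV[R]_m) : um y -> exists d, dotc d y = 1.
Proof.
rewrite /um !negb_forall => /andP[/existsP[j hj] /existsP[k hk]].
exists (((y j 0).1^-1, 0) *: delta_mx j 0 + (0, (y k 0).2^-1) *: delta_mx k 0).
rewrite dotcDl !dotcZl !dotc_delta; move: hj hk.
case: (y j 0) (y k 0) => [a b] [c d] /= a0 d0.
by congr (_, _) => /=; rewrite ?mul0r ?mulVf // ?addr0 ?add0r.
Qed.

(** Two bad events of probability at most 1 / 3, one for each field, leave probability 1 / 3; this
    is where fields with at least 3 elements enter. *)
Lemma union_bound (X : finType) (P Q : pred X) :
  3 * \sum_x (P x)%:R <= #|X|%:R :> algR -> 3 * \sum_x (Q x)%:R <= #|X|%:R :> algR ->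
  #|X|%:R <= 3 * \sum_x (~~ P x && ~~ Q x)%:R :> algR.
Proof.
move=> hP hQ.
have : (#|X|%:R : algR) <= \sum_x (P x)%:R + \sum_x (Q x)%:R + \sum_x (~~ P x && ~~ Q x)%:R.
  rewrite -sum1_card natr_sum -!big_split; apply: ler_sum => x _ /=.
  by case: (P x); case: (Q x); rewrite /= -!natrD ler_nat.
lra.
Qed.

Lemma unitR (x : R) : (x \is a GRing.unit) = (x.1 != 0) && (x.2 != 0).
Proof. by rewrite -!unitfE. Qed.

Lemma affine_unit_bound m a (y : 'cV[R]_m) : um (vec a y) ->
  #|{: 'cV[R]_m}|%:R <= 3 * \sum_(t : 'cV[R]_m) (a + dotc t y \is a GRing.unit)%:R :> algR.
Proof.
case/andP => h1 h2; under eq_bigr do rewrite unitR.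
apply: union_bound; [exact: (affine_zero_bound fst_surj F1_3 h1)|].
exact: (affine_zero_bound snd_surj F2_3 h2).
Qed.

Lemma line_um_bound m b (z : 'cV[R]_m.+1) : um (vec b z) ->
  #|{: 'cV[R]_m.+1}|%:R <= 3 * \sum_(s : 'cV[R]_m.+1) (um (z - b *: s))%:R :> algR.
Proof.
case/andP => h1 h2; apply: union_bound; [exact: (line_vanish_bound fst_surj F1_3 h1)|].
exact: (line_vanish_bound snd_surj F2_3 h2).
Qed.

Lemma um_bound m :
  #|{: 'cV[R]_m.+1}|%:R <= 3 * \sum_(v : 'cV[R]_m.+1) (um v)%:R :> algR.
Proof.
apply: union_bound; [exact: (vanish_bound fst_surj F1_3)|].
exact: (vanish_bound snd_surj F2_3).
Qed.

Section Doeblin.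
Variable m : nat.
Variable Phi : 'cV[R]_m.+2 -> algR.
Hypothesis Phi_ge0 : forall v, 0 <= Phi v.
Let X : algR := #|{: 'cV[R]_m.+1}|%:R.

(** As [a] is a unit, [y' = y + a *: s] runs over all vectors. For [y'] unimodular, [a + dotc t y']
    is then equidistributed in [R]; the other [y'] are dropped by positivity. *)
Lemma doeblin_first (Psi : 'cV[R]_m.+2 -> algR) a (y : 'cV[R]_m.+1) :
  (forall v, 0 <= Psi v) -> a \is a GRing.unit ->
  X * (\sum_b \sum_(y' : 'cV[R]_m.+1 | um y') Psi (vec b y'))
  <= #|{: R}|%:R * (\sum_s \sum_t Psi (rowU t *m (colL s *m vec a y))).
Proof.
move=> Psi0 au.
have -> : \sum_s \sum_t Psi (rowU t *m (colL s *m vec a y))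
   = \sum_(y' : 'cV[R]_m.+1) \sum_t Psi (vec (a + dotc t y') y').
  rewrite [RHS](reindex (fun s => y + a *: s)) /=; last first.
    exists (fun y' => a^-1 *: (y' - y)) => s _.
      by rewrite addrAC subrr add0r scalerA mulVr // scale1r.
    by rewrite scalerA mulrV // scale1r addrC subrK.
  by apply: eq_bigr => s _; apply: eq_bigr => t _; rewrite colLE rowUE.
rewrite exchange_big /= !mulr_sumr big_mkcond; apply: ler_sum => y' _.
case: ifP => uy; last by rewrite mulr_ge0 ?ler0n ?sumr_ge0.
have [d dy] := um_dot uy.
rewrite (@fiber_sum _ _ (fun t => a + dotc t y') (fun b => Psi (vec b y'))) //.
by move=> c; exists (c *: d) => t; rewrite dotcDl dotcZl dy mulr1 addrA.
Qed.

(** After the substitution [z = y + b *: s], the weight of [vec b z] is the number of [s] with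
    [z - b *: s] unimodular, at least a third of all [s]. *)
Lemma doeblin_last :
  X * (\sum_(w | um w) Phi w)
  <= 3 * (\sum_b \sum_(y : 'cV[R]_m.+1 | um y) \sum_s Phi (colL s *m vec b y)).
Proof.
rewrite sum_vec !mulr_sumr; apply: ler_sum => b _.
have -> : \sum_(y : 'cV[R]_m.+1 | um y) \sum_s Phi (colL s *m vec b y)
   = \sum_(z : 'cV[R]_m.+1) (\sum_(s : 'cV[R]_m.+1) (um (z - b *: s))%:R) * Phi (vec b z).
  rewrite exchange_big /=.
  under [RHS]eq_bigr do rewrite mulr_suml.
  rewrite [RHS]exchange_big /=; apply: eq_bigr => s _.
  rewrite [RHS](reindex_inj (addIr (b *: s))) /= big_mkcond; apply: eq_bigr => y _.
  by rewrite addrK colLE; case: (um y); rewrite ?mul1r ?mul0r.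
rewrite !mulr_sumr big_mkcond; apply: ler_sum => z _ /=.
have s0 : 0 <= 3 * (\sum_(s : 'cV[R]_m.+1) (um (z - b *: s))%:R) :> algR.
  by rewrite mulr_ge0 ?sumr_ge0 // => s _; rewrite ler0n.
case: ifP => uz; last by rewrite mulrA mulr_ge0.
by rewrite mulrA ler_wpM2r // line_um_bound.
Qed.

(** The first row step makes the leading coordinate a unit with probability at least 1 / 3; the next
    two steps are [doeblin_first] and the final one is [doeblin_last], which loses another factor
    3. *)
Lemma doeblin v : um v ->
  X ^+ 3 * (\sum_(w | um w) Phi w) <= 9 * #|{: R}|%:R *
  (\sum_t \sum_s \sum_t' \sum_s' Phi (colL s' *m (rowU t' *m (colL s *m (rowU t *m v))))).
Proof.
rewrite (vecP v); move: (v ord0 0) (\col_j _) => a y uv.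
set S := \sum_t _; set Psi := fun w => \sum_s' Phi (colL s' *m w).
have Psi0 w : 0 <= Psi w by apply: sumr_ge0.
set B := \sum_b \sum_(y' : 'cV[R]_m.+1 | um y') Psi (vec b y').
have B0 : 0 <= B by apply: sumr_ge0 => b _; apply: sumr_ge0.
have X0 : 0 <= X by rewrite ler0n.
have h1 : X * (X * B) <= 3 * (#|{: R}|%:R * S).
  apply: le_trans (ler_wpM2r (mulr_ge0 X0 B0) (affine_unit_bound uv)) _.
  rewrite -mulrA ler_wpM2l // [leLHS]mulr_suml [leRHS]mulr_sumr.
  apply: ler_sum => t _; rewrite rowUE.
  case: (boolP (_ \is a GRing.unit)) => [u|_].
    by rewrite mul1r; apply: (doeblin_first y Psi0 u).
  rewrite mul0r mulr_ge0 ?ler0n //.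
  by apply: sumr_ge0 => s _; apply: sumr_ge0 => t' _; apply: Psi0.
have h2 := doeblin_last; rewrite -/B in h2.
have : X * (X * (X * \sum_(w | um w) Phi w)) <= X * (X * (3 * B)) by rewrite !ler_wpM2l.
rewrite !exprS expr0 mulr1.
rewrite -!mulrA; move: h1; move: (#|{: R}|%:R * S) => Y h1 h3; apply: le_trans h3 _.
by rewrite !(mulrCA X 3); move: (X * (X * B)) h1 => Z h1; lra.
Qed.

End Doeblin.

Lemma sum_sqr_diff (T : finType) (P : pred T) (f : T -> algR) :
  (forall v, ~~ P v -> f v = 0) -> \sum_v f v = 0 ->
  \sum_(v | P v) \sum_(w | P w) (f w - f v) ^+ 2
    = 2 * (\sum_v (P v)%:R) * \sum_v f v ^+ 2.
Proof.
move=> fP f0.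
have hP (G : T -> algR) : (forall v, ~~ P v -> G v = 0) -> \sum_(v | P v) G v = \sum_v G v.
  by move=> GP; rewrite [RHS](bigID P) /= [X in _ + X]big1 ?addr0.
have f0' : \sum_(v | P v) f v = 0 by rewrite hP.
have f2 : \sum_(v | P v) f v ^+ 2 = \sum_v f v ^+ 2.
  by rewrite hP // => v /fP ->; rewrite expr0n.
set N2 := \sum_v f v ^+ 2; set c := \sum_v (P v)%:R.
have cE : \sum_(v | P v) 1 = c :> algR by rewrite big_mkcond; apply: eq_bigr => v _; case: (P v).
transitivity (\sum_(v | P v) (N2 + f v ^+ 2 * c)).
  apply: eq_bigr => v _.
  transitivity (\sum_(w | P w) (f w ^+ 2 - (2 * f v) * f w + f v ^+ 2 * 1)).
    by apply: eq_bigr => w _; ring.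
  by rewrite big_split sumrB -!mulr_sumr f0' f2 cE -/N2 /=; ring.
rewrite big_split -mulr_suml f2 -/N2 /=.
have -> : \sum_(v | P v) N2 = N2 * c by rewrite -cE mulr_sumr; under [RHS]eq_bigr do rewrite mulr1.
ring.
Qed.

(* The average over (t, s, t', s') of the displacement of f by L(s')U(t')L(s)U(t) is
   compared, by the lower bound of lemma doeblin, with the variance of f. *)
Lemma elem_gap m (f : 'cV[R]_m.+2 -> algR) (D : algR) : 0 <= D ->
  (forall i j t, i != j -> disp f (elem i j t) <= D) ->
  (forall v, ~~ um v -> f v = 0) -> \sum_v f v = 0 ->
  \sum_v f v ^+ 2 <= 300%:R * (4 ^ m.+1)%:R * D.
Proof.
move=> D0 fD fu f0; set d : algR := (4 ^ m.+1)%:R * D.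
have d0 : 0 <= d by rewrite mulr_ge0 ?ler0n.
have hU t := disp_rowU t D0 fD; have hL t := disp_colL t D0 fD.
pose g s' t' s t : 'M[R]_m.+2 := colL s' *m (rowU t' *m (colL s *m rowU t)).
(* By [disp_mul] applied three times: 22 = 2 + 4 + 8 + 8. *)
have hg s' t' s t : disp f (g s' t' s t) <= 22%:R * d.
  have [u1 d1] := hL s'; have [u2 d2] := hU t'; have [u3 d3] := hL s; have [u4 d4] := hU t.
  have u34 : colL s *m rowU t \in unitmx by rewrite unitmx_mul u3 u4.
  have u234 : rowU t' *m (colL s *m rowU t) \in unitmx by rewrite unitmx_mul u2 u34.
  have := disp_mul f (colL s') u234; have := disp_mul f (rowU t') u34.
  have := disp_mul f (colL s) u4; rewrite -/d in d1 d2 d3 d4.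
  rewrite /g; move: d1 d2 d3 d4; clearbody d.
  move: (disp f _) (disp f _) (disp f _) (disp f _) (disp f _) (disp f _) (disp f _).
  by clear=> *; lra.
set X : algR := #|{: 'cV[R]_m.+1}|%:R; set q : algR := #|{: R}|%:R.
have XS : #|{: 'cV[R]_m.+2}|%:R = q * X by rewrite /q /X -natrM !card_mx !muln1 expnS.
have q0 : 0 < q by rewrite ltr0n; apply/card_gt0P; exists 0.
have X0 : 0 < X by rewrite ltr0n; apply/card_gt0P; exists 0.
have h1 : X ^+ 3 * (2 * (\sum_(v : 'cV[R]_m.+2) (um v)%:R) * \sum_v f v ^+ 2)
    <= 9 * q * (X ^+ 4 * (22%:R * d)).
  rewrite -(@sum_sqr_diff _ (@um m.+2) f) // [leLHS]mulr_sumr.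
  apply: (@le_trans _ _ (\sum_v 9 * q * (\sum_t \sum_s \sum_t' \sum_s'
     (f (g s' t' s t *m v) - f v) ^+ 2))).
    rewrite big_mkcond; apply: ler_sum => v _; case: ifP => uv; last first.
      rewrite mulr_ge0 ?mulr_ge0 ?ler0n //.
      by do 4 (apply: sumr_ge0 => ? _); apply: sqr_ge0.
    apply: le_trans (doeblin (fun w => sqr_ge0 (f w - f v)) uv) _.
    rewrite ler_wpM2l ?mulr_ge0 ?ler0n //.
    do 4 (apply: ler_sum => ? _); by rewrite /g -!mulmxA.
  rewrite -mulr_sumr ler_wpM2l ?mulr_ge0 ?ler0n //.
  have -> : X ^+ 4 * (22%:R * d)
      = \sum_(t : 'cV[R]_m.+1) \sum_(s : 'cV[R]_m.+1) \sum_(t' : 'cV[R]_m.+1)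
          \sum_(s' : 'cV[R]_m.+1) 22%:R * d.
    rewrite !sumr_const -!mulrnA -[RHS]mulr_natl !natrM -/X !exprS expr0 mulr1.
    by rewrite !mulrA.
  do 4 (rewrite exchange_big; apply: ler_sum => ? _); exact: hg.
have hu := um_bound m.+1; rewrite XS in hu.
set N2 := \sum_v f v ^+ 2 in h1 *; have N20 : 0 <= N2 by apply: sumr_ge0 => v _; apply: sqr_ge0.
have h2 : X ^+ 3 * (2 * (q * X) * N2) <= 3 * (9 * q * (X ^+ 4 * (22%:R * d))).
  apply: le_trans (ler_wpM2l _ h1) => //; move: hu; move: (\sum_v _) => u hu.
  have X3 : 0 <= X ^+ 3 by rewrite exprn_ge0 // ltW.
  rewrite [leRHS]mulrCA ler_wpM2l // [leRHS]mulrA ler_wpM2r //.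
  by rewrite [leRHS]mulrCA ler_wpM2l.
have h3 : 0 < q * X ^+ 4 by rewrite mulr_gt0 ?exprn_gt0.
rewrite -mulrA -/d -(ler_pM2l h3).
(* Here 594 = 3 * 9 * 22, so [N2] is at most 297 [d], rounded up to 300. *)
have e1 : X ^+ 3 * (2 * (q * X) * N2) = 2 * (q * X ^+ 4 * N2) by ring.
have e2 : 3 * (9 * q * (X ^+ 4 * (22%:R * d))) = 594%:R * (q * X ^+ 4 * d) by ring.
have e3 : q * X ^+ 4 * (300%:R * d) = 300%:R * (q * X ^+ 4 * d) by ring.
rewrite e1 e2 in h2; rewrite e3.
have : 0 <= q * X ^+ 4 * d by rewrite mulr_ge0 // ltW.
by move: (q * X ^+ 4 * d) (q * X ^+ 4 * N2) h2 => a b; lra.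
Qed.

End ProductOfFields.

(** * The spectral gap of the random walk *)

Definition redm (R : pzRingType) n (A : 'M[int]_n) : 'M[R]_n := map_mx intr A.

Lemma redmM (R : pzRingType) n (A B : 'M[int]_n) : redm R (A *m B) = redm R A *m redm R B.
Proof. exact: map_mxM. Qed.

Lemma redm1 (R : pzRingType) n : redm R (1%:M : 'M[int]_n) = 1%:M.
Proof. exact: map_mx1. Qed.

Lemma redm_elem (R : pzRingType) n (i j : 'I_n) (c : int) :
  redm R (elem i j c) = elem i j c%:~R.
Proof. by rewrite /redm /elem map_mxD map_mx1 map_mxZ map_delta_mx. Qed.

Lemma inSL_unit n (A : 'M[int]_n) : inSL A -> A \in unitmx.
Proof. by rewrite unitmxE => ->; rewrite unitr1. Qed.

Lemma redm_unit (R : comUnitRingType) n (A : 'M[int]_n) : inSL A -> redm R A \in unitmx.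
Proof. by move=> h; rewrite unitmxE det_map_mx h rmorph1 unitr1. Qed.

Lemma inSL_elem n (i j : 'I_n) (c : int) : i != j -> inSL (elem i j c).
Proof.
move=> ij; rewrite /inSL.
have diag k : elem i j c k k = 1.
  rewrite !mxE eqxx; have [->|_] /= := eqVneq k i; last by rewrite mulr0 addr0.
  by rewrite (negPf ij) mulr0 addr0.
wlog : i j ij diag / (j < i)%N => [H|ji].
  case: (ltngtP i j) => [lt_ij|/(H _ _ ij diag) //|/val_inj eij]; last by rewrite eij eqxx in ij.
  rewrite -det_tr; have -> : (elem i j c)^T = elem j i c.
    by rewrite /elem linearD linearZ /= trmx1 trmx_delta.
  apply: H => //; first by rewrite eq_sym.
  by move=> k; rewrite -(diag k) !mxE andbC.
rewrite det_trig; first by apply: big1 => k _; rewrite diag.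
apply/is_trig_mxP => k l kl; rewrite !mxE.
have -> : (k == l) = false by apply/eqP => h; rewrite h ltnn in kl.
have [ki|_] /= := eqVneq k i; last by rewrite mulr0 addr0.
have [lj|_] /= := eqVneq l j; last by rewrite mulr0 addr0.
by move: kl; rewrite ki lj ltnNge ltnW.
Qed.

Section Walk.
Variables (n : nat) (S : seq 'M[int]_n).
Hypothesis HS : sym_gen_set_SL S.
Variable R : finComUnitRingType.
Implicit Type f : 'cV[R]_n -> algR.

Let S_SL s : s \in S -> inSL s. Proof. by case: HS => _ h _ _; apply: h. Qed.
Let S_inv s : s \in S -> invmx s \in S. Proof. by case: HS => _ _ h _; apply: h. Qed.

Definition walk f (v : 'cV[R]_n) : algR := \sum_(s <- S) f (redm R s *m v).
Definition sqn f : algR := \sum_v f v ^+ 2.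
Definition spread f : algR :=
  \sum_(s <- S) \sum_(s' <- S) \sum_v (f (redm R s *m v) - f (redm R s' *m v)) ^+ 2.

Lemma spread_ge0 f : 0 <= spread f.
Proof. by do 3 (apply: sumr_ge0 => ? _); apply: sqr_ge0. Qed.

(** Each [s] permutes the vectors, so every translate of [f] has the norm of [f], and expanding the
    squares leaves this identity. A bound of [sqn f] by [spread f] is thus a contraction of
    [walk]. *)
Lemma spreadE f : spread f = 2 * ((size S)%:R ^+ 2 * sqn f - sqn (walk f)).
Proof.
have sz : \sum_(s <- S) 1 = (size S)%:R :> algR by rewrite -sum1_size natr_sum.
have sq s : s \in S -> \sum_v f (redm R s *m v) ^+ 2 = sqn f.
  by move=> /S_SL/(redm_unit R) h; rewrite (sum_unitmx (fun v => f v ^+ 2)).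
transitivity (\sum_v \sum_(s <- S) \sum_(s' <- S)
    (f (redm R s *m v) - f (redm R s' *m v)) ^+ 2).
  rewrite exchange_big /=; apply: eq_bigr => s _; rewrite exchange_big //.
transitivity (\sum_v (2 * ((size S)%:R * \sum_(s <- S) f (redm R s *m v) ^+ 2)
                - 2 * walk f v ^+ 2)).
  apply: eq_bigr => v _; set W := walk f v; set Q := \sum_(s <- S) _ ^+ 2.
  transitivity (\sum_(s <- S) (f (redm R s *m v) ^+ 2 * (size S)%:R + Q
      - 2 * W * f (redm R s *m v))).
    apply: eq_bigr => s _; rewrite -sz mulr_sumr /Q /W /walk.
    rewrite mulr_sumr mulr_suml -sumrN -!big_split /=; apply: eq_bigr => s' _; ring.
  rewrite !big_split sumrN -mulr_suml -mulr_sumr /= -/W.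
  have -> : \sum_(s <- S) Q = (size S)%:R * Q.
    by rewrite -sz mulr_suml; under [RHS]eq_bigr do rewrite mul1r.
  by rewrite -/(walk f v) -/W -/Q; ring.
rewrite sumrB -!mulr_sumr exchange_big /= mulrBr; congr (2 * _ - _).
rewrite (eq_big_seq (fun=> sqn f)) //.
have -> : \sum_(s <- S) sqn f = (size S)%:R * sqn f.
  by rewrite -sz mulr_suml; under [RHS]eq_bigr do rewrite mul1r.
by rewrite expr2 mulrA.
Qed.

(** Substituting [invmx s' v] for [v] turns the displacement into a single term of [spread f],
    because [S] is symmetric. *)
Lemma disp_pair f s s' : s \in S -> s' \in S -> disp f (redm R (s *m s')) <= spread f.
Proof.
move=> sS s'S; have s'u := redm_unit R (S_SL s'S); have iS := S_inv s'S.
have -> : disp f (redm R (s *m s')) =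
    \sum_v (f (redm R s *m v) - f (redm R (invmx s') *m v)) ^+ 2.
  rewrite -(sum_unitmx (fun v => (f (redm R s *m v) - f (redm R (invmx s') *m v)) ^+ 2) s'u).
  apply: eq_bigr => v _; rewrite redmM !mulmxA -[redm R (invmx s') *m _]redmM.
  by rewrite mulVmx ?redm1 ?mul1mx //; apply/inSL_unit/S_SL.
rewrite /spread (big_rem _ sS) (big_rem _ iS) /=.
rewrite -addrA lerDl addr_ge0 //; first by do 2 (apply: sumr_ge0 => ? _); apply: sqr_ge0.
by do 3 (apply: sumr_ge0 => ? _); apply: sqr_ge0.
Qed.

(** Letters are removed two at a time by [disp_pair], while [disp_mul] accounts for the exponential
    factor. *)
Lemma disp_even_word f l : all (mem S) l -> ~~ odd (size l) ->
  disp f (redm R (mxprod l)) <= (4 ^ size l)%:R * spread f.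
Proof.
have [k] := ubnP (size l); elim: k l => // k IH [|a [|b l]] //= hk.
  by move=> _ _; rewrite redm1 disp1 mul1r spread_ge0.
case/and3P => aS bS lS; rewrite negbK => hl.
have lu : inSL (mxprod l).
  elim: {IH hk hl} l lS => [|c l IHl] /=; first by move=> _; rewrite /inSL det1.
  by case/andP => /S_SL hc /IHl; rewrite /inSL det_mulmx hc => ->; rewrite mulr1.
rewrite mulmxA [redm R (_ *m _ *m _)]redmM.
apply: le_trans (disp_mul _ _ (redm_unit R lu)) _.
have h1 := disp_pair f aS bS; have h2 : disp f (redm R (mxprod l)) <= (4 ^ size l)%:R * spread f.
  by apply: (IH l _ lS hl); rewrite ltnS in hk; apply: ltnW.
have : 1 <= (4 ^ size l)%:R :> algR by rewrite ler1n expn_gt0.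
rewrite !expnS !natrM; move: (_ ^ _)%:R h2 => x h2.
have := spread_ge0 f; move: (spread f) (disp _ _) (disp _ _) h1 h2 => a' b' c' *.
nra.
Qed.

Lemma mxprod_cat (l1 l2 : seq 'M[int]_n) : mxprod (l1 ++ l2) = mxprod l1 *m mxprod l2.
Proof. by elim: l1 => [|a l1 IH] /=; rewrite ?mul1mx // IH mulmxA. Qed.

Lemma disp_sqr_word f l : all (mem S) l ->
  disp f (redm R (mxprod l *m mxprod l)) <= (4 ^ (size l).*2)%:R * spread f.
Proof.
move=> lS; rewrite -mxprod_cat -addnn -size_cat; apply: disp_even_word.
  by rewrite all_cat lS.
by rewrite size_cat addnn odd_double.
Qed.

End Walk.

(** * Faithful characters, short words and the gap for functions on unimodular vectors *)

Lemma normr_prim_root (k : nat) (w : algC) : k.-primitive_root w -> `|w| = 1.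
Proof.
move=> wk; have k0 := prim_order_gt0 wk; apply/eqP.
by rewrite -(@pexpr_eq1 _ _ k) // -normrX (prim_expr_order wk) normr1.
Qed.

(** For distinct primes the additive group is cyclic, so one character can be faithful: raising to
    the power [q] or [p] isolates one factor. *)
Lemma faithful_character (p q : nat) : prime p -> prime q -> p != q ->
  exists e : 'F_p * 'F_q -> algC,
  [/\ e 0 = 1, forall x y, e (x + y) = e x * e y,
      forall x, e x = 1 -> x = 0 & forall x, `|e x| = 1].
Proof.
move=> pp pq pnq.
have [w1] := C_prim_root_exists (prime_gt0 pp).
have [w2] := C_prim_root_exists (prime_gt0 pq).
(* The orders are put in the form of the modulus built into the types ['F_p] and ['F_q], so that
   [prim_expr_mod] applies to sums. *)
rewrite -{1}(Fp_cast pp) -{1}(Fp_cast pq) => h2 h1.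
exists (fun x : 'F_p * 'F_q => w1 ^+ (x.1 : nat) * w2 ^+ (x.2 : nat)); split=> /=.
- by rewrite !expr0 mulr1.
- by move=> x y; rewrite !prim_expr_mod // !exprD mulrACA.
- move=> [x y] /= /eqP hxy; rewrite Fp_cast // in h1; rewrite Fp_cast // in h2.
  have hx : (p %| x)%N.
    have : w1 ^+ (x * q) == 1.
      have /eqP := congr1 (fun z => z ^+ q) (eqP hxy).
      rewrite /= exprMn -!exprM expr1n [(y * q)%N]mulnC.
      by rewrite [w2 ^+ _]exprM (prim_expr_order h2) expr1n mulr1.
    rewrite -(prim_order_dvd h1) Gauss_dvdl //.
    by rewrite prime_coprime // dvdn_prime2.
  have hy : (q %| y)%N.
    have : w2 ^+ (y * p) == 1.
      have /eqP := congr1 (fun z => z ^+ p) (eqP hxy).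
      rewrite /= exprMn -!exprM expr1n [(x * p)%N]mulnC.
      by rewrite [w1 ^+ _]exprM (prim_expr_order h1) expr1n mul1r.
    rewrite -(prim_order_dvd h2) Gauss_dvdl //.
    by rewrite prime_coprime // dvdn_prime2 // eq_sym.
  have small r (z : 'F_r) : prime r -> (r %| z)%N -> z = 0.
    move=> pr; have := ltn_ord z; rewrite [X in (_ < X)%N -> _]Fp_cast //.
    by move=> zr; rewrite /dvdn modn_small // => /eqP h; apply: val_inj.
  by rewrite (small _ _ pp hx) (small _ _ pq hy).
- by move=> x; rewrite normrM !normrX (normr_prim_root h1) (normr_prim_root h2) !expr1n mulr1.
Qed.

(** The entries 1, 2, -2 are those whose elementary matrices square to [E(2)], [E(4)], [E(-4)].
    There are finitely many cases, hence a common length bound. *)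
Lemma short_words n (S : seq 'M[int]_n) : sym_gen_set_SL S ->
  exists L, forall (i j : 'I_n) (c : int), i != j -> c \in [:: 1; 2; -2] ->
  exists l, [/\ all (mem S) l, (size l <= L)%N & elem i j c = mxprod l].
Proof.
case=> _ _ _ gen; pose cs : seq int := [:: 1; 2; -2].
have H (x : 'I_n * 'I_n * 'I_3) : exists l, x.1.1 != x.1.2 ->
    all (mem S) l /\ elem x.1.1 x.1.2 cs`_(x.2) = mxprod l.
  case: (boolP (x.1.1 != x.1.2)) => [xx|_]; last by exists [::].
  by have [l lS ->] := gen _ (inSL_elem cs`_(x.2) xx); exists l.
have {H} [w hw] := fin_all_exists H.
exists (\max_x size (w x)) => i j c ij cin.
have hc : (index c cs < 3)%N by rewrite index_mem.
have [lS e] := hw (i, j, Ordinal hc) ij.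
exists (w (i, j, Ordinal hc)); split=> //; first exact: (leq_bigmax (i, j, Ordinal hc)).
by rewrite -e /= nth_index.
Qed.

Lemma third_index n (i j : 'I_n) : (3 <= n)%N -> exists k, (i != k) && (j != k).
Proof.
move=> n3; have : (0 < #|~: [set i; j]|)%N.
  have := cardsC [set i; j]; rewrite card_ord => h.
  have : (#|[set i; j]| <= 2)%N by rewrite cards2; case: (i != j).
  lia.
by case/card_gt0P => k; rewrite !inE negb_or ![k == _]eq_sym => h; exists k.
Qed.

Lemma two_neq0_Fp p : prime p -> (2 < p)%N -> (2%:R : 'F_p) != 0.
Proof.
move=> pp p2; rewrite -(dvdn_pcharf (pchar_Fp pp)); apply/negP => /dvdn_leq.
by move/(_ isT); rewrite leqNgt p2.
Qed.

Lemma card_Fp_ge3 p : prime p -> (2 < p)%N -> (3 <= #|'F_p|)%N.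
Proof. by move=> pp; rewrite card_Fp. Qed.

Lemma spectral_gap n (S : seq 'M[int]_n) : (3 <= n)%N -> sym_gen_set_SL S ->
  exists2 K : nat, (0 < K)%N & forall (p q : nat) (f : 'cV['F_p * 'F_q]_n -> algR),
  prime p -> prime q -> p != q -> (2 < p)%N -> (2 < q)%N ->
  (forall v, ~~ um v -> f v = 0) -> \sum_v f v = 0 ->
  sqn f <= K%:R * spread S f.
Proof.
case: n S => [|[|m]] // S n3 HS; have [L hL] := short_words HS.
(* Factors from [elem_gap], from [relative_T], from its six displacements and from words of length
   at most [L.*2]. *)
exists (300 * 4 ^ m.+1 * (3000 * 6 * 4 ^ L.*2))%N; first by rewrite !muln_gt0 !expn_gt0.
move=> p q f pp pq pnq p2 q2 fu f0; set R := ('F_p * 'F_q)%type in f fu f0 *.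
have [e [e0 eD e_inj e_norm]] := faithful_character pp pq pnq.
have two : (2%:R : R) \is a GRing.unit.
  by rewrite unitR; apply/andP; split; apply: two_neq0_Fp.
set D1 : algR := (4 ^ L.*2)%:R * spread S f.
have sp0 : 0 <= spread S f by apply: spread_ge0.
have hD1 (i j : 'I_m.+2) (c : int) : i != j -> c \in [:: 1; 2; -2] ->
    disp f (elem i j (c + c)%:~R) <= D1.
  move=> ij /(hL i j c ij)[l [lS szl le]].
  rewrite -redm_elem -elemM // le; apply: le_trans (disp_sqr_word HS f lS) _.
  by apply: ler_wpM2r => //; rewrite ler_nat leq_pexp2l // leq_double.
pose C : algR := 3000%:R.
have hD (i j : 'I_m.+2) t : i != j -> disp f (elem i j t) <= C * (6 * D1).
  move=> ij; have [k /andP[ik jk]] := third_index i j n3.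
  apply: le_trans (relative_T f t (lexx C) e0 eD e_inj e_norm two ik ij _) _.
    by rewrite eq_sym.
  apply: ler_wpM2l; first by rewrite ler0n.
  have ki : k != i by rewrite eq_sym.
  have kj : k != j by rewrite eq_sym.
  have h1 : disp f (elem i j 2%:R) <= D1 by apply: (hD1 i j 1).
  have h2 : disp f (elem k j 2%:R) <= D1 by apply: (hD1 k j 1).
  have h3 : disp f (elem i k 4%:R) <= D1 by apply: (hD1 i k 2).
  have h4 : disp f (elem i k (- 4%:R)) <= D1 by apply: (hD1 i k (-2)).
  have h5 : disp f (elem k i 4%:R) <= D1 by apply: (hD1 k i 2).
  have h6 : disp f (elem k i (- 4%:R)) <= D1 by apply: (hD1 k i (-2)).
  have -> : 6 * D1 = D1 + D1 + D1 + D1 + D1 + D1 by ring.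
  exact: (lerD (lerD (lerD (lerD (lerD h1 h2) h3) h4) h5) h6).
have D10 : 0 <= C * (6 * D1) by rewrite !mulr_ge0 ?ler0n.
have := elem_gap (card_Fp_ge3 pp p2) (card_Fp_ge3 pq q2) D10 hD fu f0.
by rewrite !natrM /D1 /C !mulrA.
Qed.

Lemma vanish_mul (R : comNzRingType) (F : fieldType) (pi : {rmorphism R -> F}) n
    (A : 'M[R]_n) (v : 'cV[R]_n) : vanish pi v -> vanish pi (A *m v).
Proof.
move=> /forallP v0; apply/forallP => l; rewrite mxE rmorph_sum big1 // => k _.
by rewrite rmorphM (eqP (v0 k)) mulr0.
Qed.

Lemma um_mul (F1 F2 : finFieldType) n (A : 'M[F1 * F2]_n) v : ~~ um v -> ~~ um (A *m v).
Proof.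
rewrite /um !negb_and !negbK => /orP[] h; apply/orP; [left|right].
  exact: (vanish_mul (pi := fst)).
exact: (vanish_mul (pi := snd)).
Qed.

Section Iterate.
Variables (n : nat) (S : seq 'M[int]_n).
Hypothesis HS : sym_gen_set_SL S.

Lemma walk_um (F1 F2 : finFieldType) (f : 'cV[F1 * F2]_n -> algR) :
  (forall v, ~~ um v -> f v = 0) -> forall v, ~~ um v -> walk S f v = 0.
Proof. by move=> fu v uv; rewrite /walk big1 // => s _; rewrite fu // um_mul. Qed.

Lemma walk_sum0 (R : finComUnitRingType) (f : 'cV[R]_n -> algR) :
  \sum_v f v = 0 -> \sum_v walk S f v = 0.
Proof.
case: HS => _ SL _ _ f0; rewrite /walk exchange_big /= big_seq big1 // => s sS.
by rewrite (sum_unitmx f) //; apply/redm_unit/SL.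
Qed.

Lemma sum_words (R : finComUnitRingType) (f : 'cV[R]_n -> algR) N v :
  \sum_(w : {ffun 'I_N -> 'I_(size S)}) f (redm R (word_elt w) *m v) = iter N (@walk n S R) f v.
Proof.
elim: N f => [|N IH] f.
  rewrite (eq_bigr (fun=> f v)) => [|w _]; last first.
    by rewrite /word_elt enum_ord0 /= redm1 mul1mx.
  by rewrite sumr_const card_ffun [#|'I_0|]card_ord.
(* The first letter of a word acts last on [v], so it is absorbed into the innermost function,
   [walk f]. *)
rewrite iterSr -IH /=.
rewrite (reindex (fun sw : 'I_(size S) * {ffun 'I_N -> 'I_(size S)} =>
   [ffun i => oapp sw.2 sw.1 (unlift ord0 i)])) /=; last first.
  exists (fun w => (w ord0, [ffun j => w (lift ord0 j)])) => [[s w]|w] _ /=.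
    rewrite ffunE unlift_none; congr (_, _); apply/ffunP => j.
    by rewrite !ffunE liftK.
  apply/ffunP => i; rewrite ffunE; case: unliftP => [j|] -> //=.
  by rewrite ffunE.
rewrite -(pair_bigA _ (fun s (w : {ffun _}) =>
  f (redm R (word_elt [ffun i => oapp w s (unlift ord0 i)]) *m v))) /=.
rewrite exchange_big /=; apply: eq_bigr => w _.
rewrite /walk (big_nth 1%:M) big_mkord; apply: eq_bigr => s _; congr f.
rewrite /word_elt enum_ordSl /= ffunE unlift_none redmM -mulmxA; congr (_ *m _).
congr (redm R (mxprod _) *m v); rewrite -map_comp; apply: eq_map => j /=.
by rewrite ffunE liftK.
Qed.

Lemma walk_decay : (3 <= n)%N -> (0 < size S)%N ->
  exists2 M : nat, (1 < M)%N &
  forall (p q : nat) (f : 'cV['F_p * 'F_q]_n -> algR) (B : algR) N v,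
  prime p -> prime q -> p != q -> (2 < p)%N -> (2 < q)%N ->
  (forall v, ~~ um v -> f v = 0) -> \sum_v f v = 0 -> 0 <= B -> sqn f <= B ^+ 2 ->
  \sum_(w : {ffun 'I_N -> 'I_(size S)}) f (redm _ (word_elt w) *m v)
    <= ((size S)%:R * (1 - M%:R^-1)) ^+ N * B.
Proof.
move=> n3 k0; have [K K0 gap] := spectral_gap n3 HS.
(* The gap gives [sqn (walk g)] at most [k ^ 2 * (1 - 2 / M)] times [sqn g], and [1 - 2 / M] is at
   most the square of [1 - 1 / M]. *)
set k := size S in k0 *; pose M := (4 * K * k ^ 2)%N.
have M1 : (1 < M)%N.
  rewrite /M; have : (0 < k ^ 2)%N by rewrite expn_gt0 k0.
  by move: (k ^ 2)%N => x x0; nia.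
exists M => // p q f B N v pp pq pnq p2 q2 fu f0 B0 fB.
set th : algR := k%:R * (1 - M%:R^-1).
have Mr : 1 < M%:R :> algR by rewrite ltr1n.
have Mi : 0 < M%:R^-1 :> algR by rewrite invr_gt0; lra.
have Mi1 : M%:R^-1 <= 1 :> algR by rewrite invf_le1; lra.
have th0 : 0 <= th by rewrite mulr_ge0 ?ler0n // subr_ge0.
have step (g : 'cV['F_p * 'F_q]_n -> algR) : (forall v, ~~ um v -> g v = 0) -> \sum_v g v = 0 ->
    sqn (walk S g) <= th ^+ 2 * sqn g.
  move=> gu g0; have := gap p q g pp pq pnq p2 q2 gu g0; rewrite spreadE // -/k.
  have ek : M%:R = 4 * K%:R * k%:R ^+ 2 :> algR by rewrite /M natrM natrX natrM.
  have kr : 1 <= k%:R :> algR by rewrite ler1n.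
  have Kr : 1 <= K%:R :> algR by rewrite ler1n.
  have eM : M%:R^-1 * (4 * K%:R * k%:R ^+ 2) = 1 :> algR by rewrite -ek mulVf //; lra.
  have a0 : 0 <= sqn g by apply: sumr_ge0 => u _; apply: sqr_ge0.
  rewrite /th; move: (sqn g) (sqn (walk S g)) a0 eM kr Kr Mi => a b.
  clear; move: (M%:R^-1) (k%:R) (K%:R) => x y z a0 eM y1 z1 x0 h.
  have z0 : 0 < 2 * z by lra.
  rewrite -(ler_pM2l z0).
  have e1 : 2 * z * ((y * (1 - x)) ^+ 2 * a)
     = 2 * z * y ^+ 2 * a - (x * (4 * z * y ^+ 2)) * a + 2 * z * (y * x) ^+ 2 * a by ring.
  have e2 : 0 <= 2 * z * (y * x) ^+ 2 * a by rewrite !mulr_ge0 ?sqr_ge0 //; lra.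
  rewrite e1 eM mul1r; move: e2 h; move: (2 * z * _ * a) => c; nra.
rewrite sum_words; set g := iter N _ f.
have [gu [g0 gB]] : (forall v, ~~ um v -> g v = 0) /\ \sum_v g v = 0 /\ sqn g <= (th ^+ N * B) ^+ 2.
  rewrite /g; elim: N {g} => [|N [gu [g0 gB]]] /=; first by rewrite expr0 mul1r.
  split; first exact: walk_um; split; first exact: walk_sum0.
  apply: le_trans (step _ gu g0) _; rewrite [th ^+ N.+1]exprS -mulrA [leRHS]exprMn.
  by rewrite ler_wpM2l // sqr_ge0.
have : g v ^+ 2 <= (th ^+ N * B) ^+ 2.
  apply: le_trans gB; rewrite /sqn (bigD1 v) //= lerDl.
  by apply: sumr_ge0 => u _; apply: sqr_ge0.
have := mulr_ge0 (exprn_ge0 N th0) B0; move: (_ * B) (g v) => b x b0.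
by nra.
Qed.

End Iterate.

(** * The large sieve *)

Definition issq (F : finFieldType) (x : F) := [exists y, x == y * y].

(** A nonzero square has two distinct roots. As 0 also counts as a square, the bound has
    [#|F|.+1]. *)
Lemma card_issq (F : finFieldType) : (2%:R : F) != 0 ->
  (2 * #|[pred x : F | issq x]| <= #|F|.+1)%N.
Proof.
move=> two; rewrite -[#|F|]sum1_card.
rewrite (partition_big (fun y : F => y * y) (fun x => issq x)) /=; last first.
  by move=> y _; apply/existsP; exists y.
have i0 : issq (0 : F) by apply/existsP; exists 0; rewrite mulr0.
rewrite -sum1_card (bigD1 (0 : F)) //= [X in (_ <= X.+1)%N](bigD1 (0 : F)) //=.
have h0 : (0 < \sum_(y : F | (y * y == 0)%R) 1)%N by rewrite (bigD1 (0 : F)) //= mulr0.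
suff : (2 * \sum_(x : F | issq x && (x != 0%R)) 1
        <= \sum_(x : F | issq x && (x != 0%R)) \sum_(y : F | (y * y == x)%R) 1)%N.
  by rewrite mulnDr -addSn; apply: leq_add.
rewrite big_distrr /=; apply: leq_sum => x /andP[/existsP[y /eqP xy] x0].
have y0 : y != 0 by apply: contraNneq x0 => y0; rewrite xy y0 mulr0.
rewrite (bigD1 y) /= ?xy // (bigD1 (- y)) /=; first by lia.
rewrite mulrNN eqxx /=; apply: contra two => /eqP h.
have : 2%:R * y == 0 by rewrite mulr_natl mulr2n -{1}h addNr.
by rewrite mulf_eq0 (negPf y0) orbF.
Qed.

Section Test.
Variables (F : finFieldType) (n : nat) (i : 'I_n).
Hypothesis two : (2%:R : F) != 0.
Hypothesis F3 : (3 <= #|F|)%N.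

Let A : algR := \sum_(v : 'cV[F]_n | v != 0) 1.
Let B : algR := \sum_(v : 'cV[F]_n | v != 0) (issq (v i 0))%:R.

Definition rho := B / A.
(** Subtracting the mean over nonzero vectors makes the total sum zero; the value 0 at the zero
    vector makes products over two fields vanish off unimodular vectors. *)
Definition tst (v : 'cV[F]_n) : algR := if v == 0 then 0 else (issq (v i 0))%:R - rho.

Let A_gt0 : 0 < A.
Proof.
have d0 : delta_mx i 0 != 0 :> 'cV[F]_n.
  by apply/eqP => /colP/(_ i)/eqP; rewrite !mxE !eqxx oner_eq0.
rewrite /A (bigD1 (delta_mx i 0)) //=; apply: ltr_wpDr => //.
by apply: sumr_ge0 => v _; rewrite ler01.
Qed.

Let B_bound : 3 * B <= 2 * A.
Proof.
(* Nonsquares number at least [(#|F| - 1) / 2], which is at least [#|F| / 3] from 3 elements on. *)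
have nsq : (#|F|%:R : algR) <= 3 * \sum_(x : F) (~~ issq x)%:R.
  have h : (#|F| <= 3 * \sum_(x : F) ~~ issq x)%N.
    have := card_issq two; have := cardC [pred x : F | issq x].
    have -> : (\sum_(x : F) ~~ issq x = #|[predC [pred x : F | issq x]]|)%N.
      by rewrite -sum1_card [RHS]big_mkcond; apply: eq_bigr => x _; rewrite !inE /=; case: (issq x).
    move: F3; move: #|[predC _]| #|[pred x : F | issq x]| #|F| => a b c; lia.
  by rewrite -natr_sum -natrM ler_nat.
have fib : #|F|%:R * \sum_(v : 'cV[F]_n) (~~ issq (v i 0))%:R
    = #|{: 'cV[F]_n}|%:R * \sum_(x : F) (~~ issq x)%:R :> algR.
  apply: (@fiber_sum _ _ (fun v : 'cV[F]_n => v i 0) (fun x => (~~ issq x)%:R)) => c.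
  by exists (c *: delta_mx i 0) => v; rewrite !mxE !eqxx mulr1.
have Vn : #|{: 'cV[F]_n}|%:R <= 3 * \sum_(v : 'cV[F]_n) (~~ issq (v i 0))%:R :> algR.
  have q0 : 0 < #|F|%:R :> algR by rewrite ltr0n (leq_trans _ F3).
  rewrite -(ler_pM2l q0) mulrCA fib mulrCA.
  by rewrite mulrC ler_wpM2l ?ler0n.
have VA : #|{: 'cV[F]_n}|%:R = 1 + A by rewrite -sum1_card natr_sum (bigD1 0).
have AB : A = B + \sum_(v : 'cV[F]_n) (~~ issq (v i 0))%:R.
  rewrite [X in _ = _ + X](bigD1 0) //= mxE.
  have -> : issq (0 : F) by apply/existsP; exists 0; rewrite mulr0.
  rewrite add0r /A /B -big_split; apply: eq_bigr => v _ /=.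
  by case: issq; rewrite ?addr0 ?add0r.
lra.
Qed.

Let rho_bounds : 0 <= rho <= 2 / 3.
Proof.
apply/andP; split.
  by apply: divr_ge0; [apply: sumr_ge0 => v _; rewrite ler0n|apply: ltW].
by rewrite /rho ler_pdivrMr //; have := B_bound; move: A B => a b; lra.
Qed.

Lemma tst_sum0 : \sum_v tst v = 0.
Proof.
rewrite (bigD1 0) //= {1}/tst eqxx add0r.
rewrite (eq_bigr (fun v : 'cV[F]_n => (issq (v i 0))%:R - rho * 1)) => [|v /negPf v0]; last first.
  by rewrite /tst v0 mulr1.
by rewrite sumrB -mulr_sumr -/A -/B /rho divfK ?subrr // gt_eqF.
Qed.

Lemma tst_bound v : -1 <= tst v <= 1.
Proof.
rewrite /tst; case: eqP => _; first by rewrite ler01 lerN10.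
by case/andP: rho_bounds => ? ?; case: issq => /=; apply/andP; split; lra.
Qed.

Lemma tst_sqr v : tst v ^+ 2 <= 1.
Proof. by have := tst_bound v => /andP[? ?]; nra. Qed.

Lemma tst_sq (v : 'cV[F]_n) : v != 0 -> issq (v i 0) -> 1 / 3 <= tst v.
Proof.
move=> /negPf v0 sq; rewrite /tst v0 sq; case/andP: rho_bounds => ? ?.
rewrite /=; lra.
Qed.

End Test.

Section Pair.
Variables (F1 F2 : finFieldType) (n : nat) (i : 'I_n).
Hypothesis two1 : (2%:R : F1) != 0.
Hypothesis two2 : (2%:R : F2) != 0.
Hypothesis F1_3 : (3 <= #|F1|)%N.
Hypothesis F2_3 : (3 <= #|F2|)%N.

Definition tst2 (v : 'cV[F1 * F2]_n) : algR :=
  tst i (map_mx fst v) * tst i (map_mx snd v).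

Lemma tst2_um v : ~~ um v -> tst2 v = 0.
Proof.
have h (F : finFieldType) (pi : F1 * F2 -> F) : vanish pi v -> tst i (map_mx pi v) = 0.
  move=> /forallP v0; rewrite /tst; suff -> : map_mx pi v = 0 by rewrite eqxx.
  by apply/colP => l; rewrite !mxE; apply/eqP.
by rewrite /um negb_and !negbK /tst2 => /orP[] /h ->; rewrite ?mul0r ?mulr0.
Qed.

Lemma tst2_sum0 : \sum_v tst2 v = 0.
Proof.
rewrite (reindex (fun vw : 'cV[F1]_n * 'cV[F2]_n => \col_l (vw.1 l 0, vw.2 l 0))) /=; last first.
  exists (fun v => (map_mx fst v, map_mx snd v)) => [[v w]|v] _ /=.
    by congr (_, _); apply/colP => l; rewrite !mxE.
  by apply/colP => l; rewrite !mxE -surjective_pairing.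
transitivity (\sum_(vw : 'cV[F1]_n * 'cV[F2]_n) tst i vw.1 * tst i vw.2).
  apply: eq_bigr => [[v w]] _ /=; rewrite /tst2.
  by congr (_ * _); congr tst; apply/colP => l; rewrite !mxE.
rewrite -(pair_bigA _ (fun v w => tst i v * tst i w)) /= big1 // => v _.
by rewrite -mulr_sumr tst_sum0 ?mulr0.
Qed.

Lemma tst2_sqn : sqn tst2 <= (#|F1| * #|F2|)%:R ^+ n.
Proof.
have -> : (#|F1| * #|F2|)%:R ^+ n = \sum_(v : 'cV[F1 * F2]_n) 1 :> algR.
  by rewrite sumr_const card_mx card_prod muln1 natrX.
apply: ler_sum => v _; rewrite /tst2 exprMn.
have := tst_sqr i two1 F1_3 (map_mx fst v); have := tst_sqr i two2 F2_3 (map_mx snd v).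
have := sqr_ge0 (tst i (map_mx fst v)); have := sqr_ge0 (tst i (map_mx snd v)).
move: (_ ^+ 2) (_ ^+ 2) => a b; nra.
Qed.

End Pair.

Lemma map_fst_redm (R1 R2 : pzRingType) n (A : 'M[int]_n) (j : 'I_n) :
  map_mx fst (redm (R1 * R2)%type A *m delta_mx j (0 : 'I_1))
    = redm R1 A *m delta_mx j 0.
Proof.
rewrite -!colE; apply/colP => l; rewrite !mxE; move: (A l j) => c.
exact: (rmorph_int (fst : {rmorphism R1 * R2 -> R1})).
Qed.

Lemma map_snd_redm (R1 R2 : pzRingType) n (A : 'M[int]_n) (j : 'I_n) :
  map_mx snd (redm (R1 * R2)%type A *m delta_mx j (0 : 'I_1))
    = redm R2 A *m delta_mx j 0.
Proof.
rewrite -!colE; apply/colP => l; rewrite !mxE; move: (A l j) => c.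
exact: (rmorph_int (snd : {rmorphism R1 * R2 -> R2})).
Qed.

Definition square_words n (S : seq 'M[int]_n) N (i j : 'I_n) :=
  [set w : {ffun 'I_N -> 'I_(size S)} | `[< exists m, word_elt w i j = m * m >]].

Lemma word_elt_SL n (S : seq 'M[int]_n) N (w : {ffun 'I_N -> 'I_(size S)}) :
  sym_gen_set_SL S -> inSL (word_elt w).
Proof.
case=> _ SL _ _; rewrite /word_elt; elim: (enum 'I_N) => [|i s IH] /=.
  by rewrite /inSL det1.
by rewrite /inSL det_mulmx IH mulr1; apply: SL; apply: mem_nth.
Qed.

Lemma tst_square_word n (S : seq 'M[int]_n) N (w : {ffun 'I_N -> 'I_(size S)})
    (i j : 'I_n) (F : finFieldType) (m : int) :
  sym_gen_set_SL S -> (2%:R : F) != 0 -> (3 <= #|F|)%N -> word_elt w i j = m * m ->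
  1 / 3 <= tst i (redm F (word_elt w) *m delta_mx j 0).
Proof.
move=> HS two F3 wm; have wu := redm_unit F (word_elt_SL w HS).
apply: tst_sq => //; last first.
  by rewrite -colE !mxE wm; apply/existsP; exists m%:~R; rewrite rmorphM.
apply/eqP => h; have : delta_mx j 0 = 0 :> 'cV[F]_n by rewrite -(mulKmx wu (delta_mx _ _)) h mulmx0.
by move/colP/(_ j)/eqP; rewrite !mxE !eqxx oner_eq0.
Qed.

Lemma sieve n (S : seq 'M[int]_n) : (3 <= n)%N -> sym_gen_set_SL S -> (0 < size S)%N ->
  exists2 M : nat, (1 < M)%N &
  forall (i j : 'I_n) (P : seq nat) (x N : nat), uniq P ->
  (forall p, p \in P -> [&& prime p, 2 < p & p <= x]%N) ->
  #|square_words S N i j|%:R * (size P)%:R ^+ 2 <=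
  9 * ((size P)%:R * (size S)%:R ^+ N
       + (size P)%:R ^+ 2 * (((size S)%:R * (1 - M%:R^-1)) ^+ N * (x * x)%:R ^+ n)) :> algR.
Proof.
move=> n3 HS k0; have [M M1 decay] := walk_decay HS n3 k0.
exists M => // i j P x N uP hP; set k := size S in k0 decay *.
set th : algR := k%:R * (1 - M%:R^-1).
pose t p (w : {ffun 'I_N -> 'I_k}) := tst i (redm 'F_p (word_elt w) *m delta_mx j 0).
set T := th ^+ N * _.
have th0 : 0 <= th.
  by rewrite mulr_ge0 ?ler0n // subr_ge0 invf_le1 ?ler1n ?ltr0n (ltnW, ltnW M1) // ltnW.
have T0 : 0 <= T by rewrite mulr_ge0 ?exprn_ge0 ?ler0n.
have diag p : p \in P -> \sum_w t p w * t p w <= k%:R ^+ N.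
  move=> /hP /and3P[pp p2 _].
  have -> : k%:R ^+ N = \sum_(w : {ffun 'I_N -> 'I_k}) 1 :> algR.
    by rewrite sumr_const card_ffun !card_ord natrX.
  by apply: ler_sum => w _; apply: tst_sqr (two_neq0_Fp pp p2) (card_Fp_ge3 pp p2) _.
have off p q : p \in P -> q \in P -> p != q -> \sum_w t p w * t q w <= T.
  move=> /hP /and3P[pp p2 px] /hP /and3P[pq q2 qx] pnq.
  have c0 : (0 < p * q)%N by rewrite muln_gt0 !prime_gt0.
  (* The bound squares a quantity already dominating [sqn], which avoids extracting a square
     root. *)
  have h : sqn (@tst2 'F_p 'F_q n i) <= ((x * x)%:R ^+ n) ^+ 2.
    apply: le_trans (tst2_sqn i (two_neq0_Fp pp p2) (two_neq0_Fp pq q2)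
       (card_Fp_ge3 pp p2) (card_Fp_ge3 pq q2)) _.
    rewrite !card_Fp // -!natrX ler_nat -expnM.
    have pqx : (p * q <= x * x)%N by rewrite leq_mul.
    apply: (@leq_trans ((x * x) ^ n)); first by rewrite leq_exp2r // (leq_trans _ n3).
    by rewrite leq_pexp2l ?(leq_trans c0) // muln2 -addnn leq_addr.
  have := decay p q _ _ N (delta_mx j 0) pp pq pnq p2 q2 (@tst2_um _ _ _ i) _ _ h.
  move=> /(_ (tst2_sum0 _ _ i)) /(_ (exprn_ge0 _ (ler0n _ _))).
  apply: le_trans; apply: ler_sum => w _; rewrite /tst2 map_fst_redm map_snd_redm //.
have Z2 : \sum_w (\sum_(p <- P) t p w) ^+ 2 <= (size P)%:R * k%:R ^+ N + (size P)%:R ^+ 2 * T.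
  have -> : \sum_w (\sum_(p <- P) t p w) ^+ 2 = \sum_(p <- P) \sum_(q <- P) \sum_w t p w * t q w.
    transitivity (\sum_w \sum_(p <- P) \sum_(q <- P) t p w * t q w).
      by apply: eq_bigr => w _; rewrite expr2 mulr_suml; apply: eq_bigr => p _; rewrite mulr_sumr.
    rewrite exchange_big /=; apply: eq_bigr => p _; rewrite exchange_big //.
  have -> : (size P)%:R * k%:R ^+ N + (size P)%:R ^+ 2 * T
     = \sum_(p <- P) (k%:R ^+ N + (size P)%:R * T).
    by rewrite big_const_seq count_predT iter_addr_0 -[RHS]mulr_natl mulrDr expr2 mulrA.
  rewrite big_seq [leRHS]big_seq; apply: ler_sum => p pP.
  rewrite (big_rem p) //=; apply: lerD; first exact: diag.
  have -> : (size P)%:R * T = \sum_(q <- P) T.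
    by rewrite big_const_seq count_predT iter_addr_0 mulr_natl.
  rewrite [leRHS](big_rem p) //= -[leLHS]add0r; apply: lerD => //.
  rewrite big_seq [leRHS]big_seq; apply: ler_sum => q.
  by rewrite mem_rem_uniq // !inE => /andP[qp qP]; apply: off => //; rewrite eq_sym.
(* Chebyshev's inequality: on a square word every prime contributes at least 1 / 3. *)
have low : #|square_words S N i j|%:R * (size P)%:R ^+ 2 <= 9 * \sum_w (\sum_(p <- P) t p w) ^+ 2.
  rewrite -sum1_card natr_sum mulr_suml big_mkcond mulr_sumr; apply: ler_sum => w _.
  case: ifP => [|_]; last by rewrite mulr_ge0 ?sqr_ge0.
  rewrite inE => /asboolP[m wm]; rewrite mul1r.
  have : (size P)%:R * (1 / 3) <= \sum_(p <- P) t p w.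
    have -> : (size P)%:R * (1 / 3) = \sum_(p <- P) (1 / 3) :> algR.
      by rewrite big_const_seq count_predT iter_addr_0 mulr_natl.
    rewrite big_seq [leRHS]big_seq; apply: ler_sum => p /hP /and3P[pp p2 _].
    exact: tst_square_word (two_neq0_Fp pp p2) (card_Fp_ge3 pp p2) wm.
  have : 0 <= (size P)%:R :> algR by rewrite ler0n.
  by move: (_%:R) (\sum_(p <- P) _) => a b; nra.
by apply: le_trans low _; rewrite ler_wpM2l.
Qed.

(** * Counting primes *)

(** By Pascal's rule and symmetry, the central coefficient at least doubles at each step. *)
Lemma central_bin_ge m : (2 ^ m <= 'C(m.*2, m))%N.
Proof.
elim: m => // m IH; rewrite doubleS expnS.
have h : 'C(m.*2.+1, m) = 'C(m.*2.+1, m.+1).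
  by rewrite -(@bin_sub _ m.+1) -?addnn; [congr 'C(_, _)|]; lia.
by rewrite binS h binS; lia.
Qed.

(** In Legendre's formula, each term for [m.*2] exceeds twice the term for [m] by at most 1, and all
    terms vanish once [p ^ k] exceeds [m.*2]. *)
Lemma logn_central_bin p m : prime p -> (0 < m)%N ->
  (p ^ logn p 'C(m.*2, m) <= m.*2)%N.
Proof.
move=> pp m0; set t := trunc_log p m.*2.
have m20 : (0 < m.*2)%N by rewrite double_gt0.
apply: leq_trans (trunc_logP (prime_gt1 pp) m20); rewrite leq_pexp2l ?prime_gt0 //.
have pk k : (m < k)%N -> (m %/ p ^ k = 0)%N.
  move=> mk; apply: divn_small; apply: leq_trans mk _.
  by apply: ltnW; apply: ltn_expl; apply: prime_gt1.
(* Zero terms extend the range, so that it matches the one for [m.*2]. *)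
have e1 : logn p m`! = (\sum_(1 <= k < m.*2.+1) m %/ p ^ k)%N.
  rewrite logn_fact // [RHS](@big_cat_nat _ _ _ m.+1) //=; last by rewrite ltnS -addnn leq_addr.
  by rewrite [X in (_ + X)%N]big_nat [X in (_ + X)%N]big1 ?addn0 // => k /andP[/pk].
have := bin_fact (leq_addr m m); rewrite addnn -{2}addnn addnK => /(congr1 (logn p)).
rewrite !lognM ?muln_gt0 ?fact_gt0 ?bin_gt0 -?addnn ?leq_addr // addnn.
rewrite e1 logn_fact // => e2.
have : (\sum_(1 <= k < m.*2.+1) m.*2 %/ p ^ k
   <= \sum_(1 <= k < m.*2.+1) ((m %/ p ^ k) + (m %/ p ^ k) + (k <= t)))%N.
  rewrite big_nat [X in (_ <= X)%N]big_nat; apply: leq_sum => k _.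
  have q0 : (0 < p ^ k)%N by rewrite expn_gt0 prime_gt0.
  case: (leqP k t) => kt; last first.
    rewrite divn_small //; apply: leq_trans (trunc_log_ltn _ (prime_gt1 pp)) _.
    by rewrite leq_pexp2l ?prime_gt0.
  move: (p ^ k)%N q0 => q q0; rewrite -ltnS ltn_divLR //.
  have := divn_eq m q; have := ltn_pmod m q0; rewrite -addnn.
  by move: (m %/ q)%N (m %% q)%N => a b hb ->; rewrite /= ; nia.
rewrite !big_split /=.
have : (\sum_(1 <= k < m.*2.+1) (k <= t) <= t)%N.
  elim: (m.*2) => [|u IH]; first by rewrite big_geq.
  rewrite big_nat_recr //=; case: (leqP u.+1 t) => ut; last by rewrite addn0.
  apply: (@leq_trans (u + 1)%N); last by rewrite addn1.
  rewrite leq_add2r -[X in (_ <= X)%N](subn1 u.+1) -[X in (_ <= X)%N]muln1 -sum_nat_const_nat.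
  by apply: leq_sum => k _; apply: leq_b1.
lia.
Qed.

(* The odd prime divisors of the central binomial coefficient 'C(2m, m), m = 2^(2c+4). *)
Lemma many_primes c : exists P : seq nat,
  [/\ uniq P, forall p, p \in P -> [&& prime p, 2 < p & p <= 2 ^ (c.*2 + 5)]%N
    & (2 ^ c <= size P)%N].
Proof.
set a := (c.*2 + 4)%N; pose m := (2 ^ a)%N; set B := 'C(m.*2, m).
have m0 : (0 < m)%N by rewrite expn_gt0.
have B0 : (0 < B)%N by rewrite bin_gt0 -addnn leq_addr.
have m2 : m.*2 = (2 ^ a.+1)%N by rewrite expnS mul2n.
have hp p : p \in primes B -> (p <= m.*2)%N.
  rewrite mem_primes => /and3P[pp _ pB]; apply: leq_trans (logn_central_bin pp m0).
  rewrite -[X in (X <= _)%N]expn1; apply: leq_pexp2l; first exact: prime_gt0.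
  by rewrite logn_gt0 mem_primes pp B0.
(* Each prime power in [B] is at most [m.*2 = 2 ^ a.+1], while [B] is at least [2 ^ m]; compare
   exponents of 2. *)
have key : (m <= a.+1 * size (primes B))%N.
  rewrite -(@leq_exp2l 2) // expnM -m2; apply: leq_trans (central_bin_ge m) _.
  rewrite -/B {1}(prod_prime_decomp B0) prime_decompE big_map /=.
  rewrite -[X in (_ <= X)%N]iter_muln_1 -(count_predT (primes B)) -big_const_seq.
  rewrite big_seq [X in (_ <= X)%N]big_seq; apply: leq_prod => p.
  by rewrite mem_primes => /andP[pp _]; apply: logn_central_bin.
exists [seq p <- primes B | 2 < p]%N; split.
- by rewrite filter_uniq ?primes_uniq.
- move=> p; rewrite mem_filter => /andP[-> pB]; rewrite /= (leq_trans (hp p pB)) ?m2 ?andbT.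
    by move: pB; rewrite mem_primes => /andP[].
  by rewrite /a -addnS.
have sz : (size (primes B) <= (size [seq p <- primes B | 2 < p]).+1)%N.
  rewrite -(count_predC (fun p => 2 < p)%N (primes B)) size_filter.
  rewrite -[X in (_ <= X)%N]addn1 leq_add2l.
  rewrite -size_filter; apply: (@uniq_leq_size _ _ [:: 2%N]).
    by rewrite filter_uniq ?primes_uniq.
  move=> p; rewrite mem_filter mem_primes /= -leqNgt inE => /and3P[p2 pp _].
  by rewrite eqn_leq p2 prime_gt1.
(* With [u = 2 ^ c], [key] reads [16 * u ^ 2 <= (2 * c + 5) * s]. If [s' < u], then [s <= u] and
   [16 * u <= 2 * c + 5 <= 2 * u + 3], which is absurd. *)
move: key sz; rewrite /m /a; move: (size _) (size _) => s s'.
have : (c.+1 <= 2 ^ c)%N by apply: ltn_expl.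
rewrite expnD -muln2 expnM -mulnn -[(2 ^ 4)%N]/16%N.
move: (2 ^ c)%N => u; nia.
Qed.

(** * Conclusion *)

(** Bernoulli's inequality for [(1 + 1 / m) ^ T], cleared of denominators. *)
Lemma bernoulli_nat m T : (m ^ T * (m + T) <= m.+1 ^ T * m)%N.
Proof. by elim: T => [|T IH]; rewrite ?addn0 ?expnS //; nia. Qed.

Lemma exp_ratio m A : (0 < m)%N -> exists2 T, (0 < T)%N & (A * m ^ T <= m.+1 ^ T)%N.
Proof.
move=> m0; exists (m * A.+1)%N; first by rewrite muln_gt0 m0.
have := bernoulli_nat m (m * A.+1); rewrite -mulnS => h.
rewrite -(leq_pmul2r m0); apply: leq_trans h.
by move: (m ^ _)%N => u; nia.
Qed.

Lemma expn_mono a b e : (a <= b)%N -> (a ^ e <= b ^ e)%N.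
Proof. by move=> ab; elim: e => // e IH; rewrite !expnS leq_mul. Qed.

Lemma count_square_words_le n (S : seq 'M[int]_n) N :
  (count_square_words S N <= \sum_i \sum_j #|square_words S N i j|)%N.
Proof.
rewrite /count_square_words -sum1_card big_mkcond /=.
under [X in (_ <= X)%N]eq_bigr => i _.
  under eq_bigr => j _ do rewrite -sum1_card big_mkcond /=.
  rewrite exchange_big /=; over.
rewrite exchange_big /=; apply: leq_sum => w _; case: ifP => //.
rewrite inE => /asboolP[i [j [x wx]]].
rewrite (bigD1 i) //= (bigD1 j) //= inE.
by have -> : `[< exists m, word_elt w i j = m * m >] by apply/asboolP; exists x.
Qed.

Lemma square_words_decay n (S : seq 'M[int]_n) :
  (3 <= n)%N -> sym_gen_set_SL S -> (0 < size S)%N ->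
  exists T C : nat, (0 < T)%N /\ forall N,
  (count_square_words S N * 2 ^ (N %/ T) <= C * size S ^ N)%N.
Proof.
move=> n3 HS k0; have [M M1 hM] := sieve n3 HS k0; set k := size S in k0 hM *.
case: M M1 hM => [//|m] m1 hM.
have m0 : (0 < m)%N by [].
(* In each block of [T] letters, the spectral decay must pay for the growth [2 ^ (4 * n)] of
   [(x * x) ^ n] and still gain a factor 2. *)
have [T T0 hT] := exp_ratio (2 ^ (4 * n).+1) m0.
exists T, (n * n * (9 * (1 + 2 ^ (10 * n))))%N; split=> // N.
set c := (N %/ T)%N.
have cnt i j : (#|square_words S N i j| * 2 ^ c <= 9 * (1 + 2 ^ (10 * n)) * k ^ N)%N.
  (* At least [2 ^ c] sieving primes, so the diagonal term gains [2 ^ c] as well. *)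
  have [P [uP hP szP]] := many_primes c.
  have := hM i j P _ N uP hP; set x := (2 ^ _)%N; set s := #|_|.
  have hx : ((x * x) ^ n = 2 ^ ((4 * n) * c) * 2 ^ (10 * n))%N.
    by rewrite /x -expnD -expnM -expnD; congr (2 ^ _)%N; rewrite -muln2; lia.
  move=> h.
  have : (s * size P ^ 2 * m.+1 ^ N <=
      9 * (size P * (k * m.+1) ^ N + size P ^ 2 * ((k * m) ^ N * (x * x) ^ n)))%N.
    rewrite -(ler_nat algR).
    have Mr : 0 < m.+1%:R ^+ N :> algR by rewrite exprn_gt0 ?ltr0n.
    have := h; rewrite -(ler_pM2r Mr) => h'.
    have e1 : (s * size P ^ 2 * m.+1 ^ N)%:R = s%:R * (size P)%:R ^+ 2 * m.+1%:R ^+ N :> algR.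
      by rewrite !natrM !natrX.
    rewrite e1; apply: le_trans h' _; rewrite le_eqVlt; apply/orP; left; apply/eqP.
    have e2 : (k%:R * (1 - m.+1%:R^-1)) ^+ N * m.+1%:R ^+ N = (k * m)%:R ^+ N :> algR.
      rewrite -exprMn -mulrA mulrBl mul1r mulVf ?pnatr_eq0 //.
      by rewrite -natr1 addrK natrM.
    have -> : (9 * (size P * (k * m.+1) ^ N + size P ^ 2 * ((k * m) ^ N * (x * x) ^ n)))%:R
      = 9 * ((size P)%:R * (k%:R * m.+1%:R) ^+ N
         + (size P)%:R ^+ 2 * ((k * m)%:R ^+ N * (x * x)%:R ^+ n)) :> algR.
      rewrite natrM natrD (natrM _ (size P)) (natrM _ (size P ^ 2)).
      by rewrite (natrM _ ((k * m) ^ N)) !natrX -natrM.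
    rewrite -e2 [(k%:R * m.+1%:R) ^+ N]exprMn.
    move: (_ ^+ N) (_ ^+ N) (_ ^+ N) (_ ^+ n) (size P)%:R => a b d e f.
    by ring.
  rewrite hx !expnMn => h1.
  have k2 : (2 ^ (4 * n * c) * 2 ^ c * m ^ N <= m.+1 ^ N)%N.
    rewrite -expnD addnC -mulSn (divn_eq N T) -/c [(c * T)%N]mulnC expnM.
    rewrite (expnD m) (expnD m.+1) (expnM m) (expnM m.+1) mulnA -expnMn.
    by apply: leq_mul; apply: expn_mono.
  have P0 : (0 < size P)%N by apply: leq_trans szP; rewrite expn_gt0.
  have MN0 : (0 < m.+1 ^ N)%N by rewrite expn_gt0.
  have Z0 : (0 < size P ^ 2 * m.+1 ^ N)%N by rewrite muln_gt0 expn_gt0 P0.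
  rewrite -(leq_pmul2r Z0).
  apply: (@leq_trans (9 * (size P * (k ^ N * m.+1 ^ N) * 2 ^ c
     + size P ^ 2 * k ^ N * 2 ^ (10 * n) * (2 ^ (4 * n * c) * 2 ^ c * m ^ N)))).
    have := leq_mul h1 (leqnn (2 ^ c)).
    move: (size P ^ 2)%N (2 ^ c)%N (k ^ N)%N (m.+1 ^ N)%N (m ^ N)%N.
    move: (2 ^ (4 * n * c))%N (2 ^ (10 * n))%N.
    by move: (size P) => p a5 a6 p2 a1 a2 a3 a4; nia.
  apply: (@leq_trans (9 * (size P * (k ^ N * m.+1 ^ N) * size P
     + size P ^ 2 * k ^ N * 2 ^ (10 * n) * m.+1 ^ N))).
    by rewrite leq_mul2l leq_add // leq_mul2l ?szP ?k2 orbT.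
  rewrite -mulnn; move: (k ^ N)%N (m.+1 ^ N)%N (2 ^ (10 * n))%N (size P) => a1 a2 a3 a4.
  by rewrite leq_eqVlt; apply/orP; left; apply/eqP; ring.
apply: (@leq_trans (\sum_(i < n) \sum_(j < n) #|square_words S N i j| * 2 ^ c)%N).
  under eq_bigr do rewrite -big_distrl.
  by rewrite -big_distrl leq_mul2r count_square_words_le orbT.
apply: leq_trans (leq_sum _ (fun i _ => leq_sum _ (fun j _ => cnt i j))) _.
by rewrite !sum_nat_const !card_ord !mulnA.
Qed.

Lemma count_square_words_card n (S : seq 'M[int]_n) N :
  (count_square_words S N <= size S ^ N)%N.
Proof. by apply: leq_trans (max_card _) _; rewrite card_ffun !card_ord. Qed.

(* From here on %R denotes the scope of Stdlib reals, and Lra.lra avoids the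
   homonymous tactic of algebra-tactics. *)
From Stdlib Require Import Reals Lra.
Local Open Scope nat_scope.

(** For base 0 this rests on the convention that [ln] is 0 at nonpositive arguments. *)
Lemma Rpower_small_base (k : nat) (y : R) : (k <= 1)%N -> Rpower (INR k) y = 1%R.
Proof.
move=> k1; rewrite /Rpower; suff -> : ln (INR k) = 0%R by rewrite Rmult_0_r exp_0.
case: k k1 => [|[|//]] _; last exact: ln_1.
by rewrite /ln; case: Rlt_dec => // h; case: (Rlt_irrefl _ h).
Qed.

Lemma INR_expn a b : INR (expn a b) = (INR a ^ b)%R.
Proof. by elim: b => [//|b IH]; rewrite expnS mult_INR IH. Qed.

Theorem theorem1p3 (n : nat) (S : seq 'M[int]_n) :
  (3 <= n)%N -> @sym_gen_set_SL n S ->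
  exists (beta C : R), (0 < beta)%R /\
    forall N : nat, (1 <= N)%N ->
      (INR (@count_square_words n S N) <=
         C * Rpower (INR (size S)) (INR N * (1 - beta)))%R.
Proof.
move=> n3 HS; case: (leqP (size S) 1) => [k1|k2].
  exists 1%R, 1%R; split; first Lra.lra.
  move=> N N1; rewrite Rpower_small_base // Rmult_1_r; apply: (le_INR _ 1); apply/ssrnat.leP.
  apply: leq_trans (count_square_words_card S N) _.
  by rewrite -(exp1n N) expn_mono.
have k0 : (0 < size S)%N by apply: ltnW.
have [T [C [T0 hTC]]] := square_words_decay n3 HS k0.
set k := INR (size S).
have kgt1 : (1 < k)%R by apply: (lt_INR 1); apply/ssrnat.ltP.
have Tgt0 : (0 < INR T)%R by apply: (lt_INR 0); apply/ssrnat.ltP.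
have lnk : (0 < ln k)%R by rewrite -ln_1; apply: ln_increasing; Lra.lra.
have ln2 : (0 < ln 2)%R by rewrite -ln_1; apply: ln_increasing; Lra.lra.
(* This [beta] turns the saving [k ^ (- N * beta)] into [2 ^ (- N / T)]; the factor 2 in the
   constant absorbs the rounding of [N / T] down to [c]. *)
exists (ln 2 / (INR T * ln k))%R, (2 * INR C)%R; split.
  by apply: Rdiv_lt_0_compat => //; apply: Rmult_lt_0_compat.
move=> N _; set c := (N %/ T)%N.
have NT : (INR N / INR T <= INR c + 1)%R.
  apply: (Rmult_le_reg_r (INR T)) => //; rewrite /Rdiv Rmult_assoc Rinv_l; last Lra.lra.
  rewrite Rmult_1_r -S_INR -mult_INR; apply: le_INR; apply/ssrnat.leP.
  by apply: ltnW; rewrite multE -ltn_divLR.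
have hR : (INR (count_square_words S N) * 2 ^ c <= INR C * k ^ N)%R.
  have -> : (2 = INR 2)%R by [].
  by rewrite /k -!INR_expn -!mult_INR; apply: le_INR; apply/ssrnat.leP; apply: hTC.
have -> : Rpower k (INR N * (1 - ln 2 / (INR T * ln k))) = (k ^ N * Rpower 2 (- (INR N / INR T)))%R.
  rewrite -Rpower_pow; last Lra.lra.
  have hb : (ln 2 / (INR T * ln k) * ln k = ln 2 / INR T)%R.
    by rewrite /Rdiv Rinv_mult !Rmult_assoc Rinv_l ?Rmult_1_r //; Lra.lra.
  rewrite /Rpower -exp_plus; congr exp.
  transitivity (INR N * ln k - INR N * (ln 2 / (INR T * ln k) * ln k))%R; first Lra.lra.
  by rewrite hb /Rdiv; Lra.lra.
have h2 : (/ (2 * 2 ^ c) <= Rpower 2 (- (INR N / INR T)))%R.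
  rewrite tech_pow_Rmult -(Rpower_pow c.+1); last Lra.lra.
  rewrite -Rpower_Ropp; apply: Rle_Rpower; first Lra.lra.
  by rewrite S_INR; Lra.lra.
have p2 : (0 < 2 ^ c)%R by apply: pow_lt; Lra.lra.
have kN : (0 < k ^ N)%R by apply: pow_lt; Lra.lra.
have C0 : (0 <= INR C)%R by apply: pos_INR.
apply: (Rle_trans _ (INR C * k ^ N * / 2 ^ c)).
  apply: (Rmult_le_reg_r (2 ^ c)) => //.
  by rewrite Rmult_assoc Rinv_l ?Rmult_1_r //; Lra.lra.
have -> : (INR C * k ^ N * / 2 ^ c = 2 * INR C * (k ^ N * / (2 * 2 ^ c)))%R.
  by rewrite Rinv_mult; Lra.lra.
apply: Rmult_le_compat_l; first Lra.lra.
by apply: Rmult_le_compat_l => //; Lra.lra.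
Qed.
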